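(* Let $k_0$ be a perfect field with algebraic closure $K$. For every integer $n\ge1$ prime with $\operatorname{char}k_0$, the group $\mu_n\subseteq\mathbb G_m(K)$ is neutral. Hence, every finite subgroup of $\mathbb G_m(K)$ is neutral.
   Context: Every field $k$ considered is an extension of $k_0$. Let $\Gamma$ be an affine group scheme of finite type over $k_0$ (here $\Gamma=\mathbb G_m=\mathrm{GL}_1$) and $j:G\hookrightarrow\Gamma(K)$ a finite subgroup such that every $\mathrm{Gal}(K/k_0)$-conjugate of $G$ is $\Gamma(K)$-conjugate to $G$ (automatic here). A $j$-gerbe over an extension $k/k_0$ is a gerbe $\mathcal G$ over $k$ with a faithful morphism $\mathcal G\to B\Gamma$ such that, for one (hence every) geometric point $p$ of $\mathcal G$ over $\bar k$, the image of $\underline{\mathrm{Aut}}_{\mathcal G}(p)$ in $\Gamma_{\bar k}$ (after choosing an isomorphism of the image of $p$ with the tautological section of $B\Gamma$ and an embedding $K\subseteq\bar k$ over $k_0$) is $\Gamma(\bar k)$-conjugate to $G$. The subgroup $G\subseteq\Gamma(K)$ is neutral if, for every extension $k/k_0$ and every $j$-gerbe $\mathcal G$ over $k$, $\mathcal G(k)\neq\emptyset$. *)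

(* Defs.v *)
From HB Require Import structures.
From mathcomp Require Import all_boot all_order all_algebra all_field.
From mathcomp Require Import boolp.
Set Implicit Arguments.
Unset Strict Implicit.
Unset Printing Implicit Defensive.
Import GRing.Theory.
Local Open Scope ring_scope.
#[local] Obligation Tactic := idtac.

(* Affine k-schemes are handled through the opposite category, that of
   commutative k-algebras.  The zero ring is allowed (empty scheme), which is
   why rings are comPzRingType. *)

Record kalg (k : fieldType) := KAlg {
  kring :> comPzRingType;
  kstr : {rmorphism k -> kring} }.

(* Spec B -> Spec A over k *)
Record khom (k : fieldType) (A B : kalg k) := KHom {
  kfun :> {rmorphism A -> B};
  kfun_str : forall c : k, kfun (kstr A c) = kstr B c }.

Lemma rmorph_eq (A B : comPzRingType) (f g : {rmorphism A -> B}) :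
  f =1 g -> f = g.
Proof.
case: f g => [f [[f1] [f2]]] [g [[g1] [g2]]] /= fg.
have e : f = g by apply: funext.
by case: g / e g1 g2 {fg} => g1 g2; rewrite (Prop_irrelevance g1 f1) (Prop_irrelevance g2 f2).
Qed.

Lemma khom_eq (k : fieldType) (A B : kalg k) (f g : khom A B) : f =1 g -> f = g.
Proof.
case: f g => [f fP] [g gP] /= fg.
have e := rmorph_eq fg.
by case: g / e gP {fg} => gP; rewrite (Prop_irrelevance fP gP).
Qed.

Definition kid (k : fieldType) (A : kalg k) : khom A A :=
  @KHom k A A idfun (fun=> erefl).

Program Definition kcomp (k : fieldType) (A B C : kalg k)
  (g : khom B C) (f : khom A B) : khom A C :=
  @KHom k A C (g \o f) _.
Next Obligation. by move=> k A B C g f c; rewrite /= !kfun_str. Qed.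

Definition kself (k : fieldType) : kalg k := @KAlg k k idfun.

Definition is_base_change (A B : comPzRingType) (phi : {rmorphism A -> B})
  (M : lmodType A) (MB : lmodType B) (eta : {linear M -> MB | phi \; *:%R}) :=
  forall (P : lmodType B) (g : {linear M -> P | phi \; *:%R}),
    exists2 h : {linear MB -> P}, h \o eta =1 g &
      forall h' : {linear MB -> P}, h' \o eta =1 g -> h' =1 h.

(* (B (x)_A -) preserves injections *)
Definition flat (A B : comPzRingType) (phi : {rmorphism A -> B}) :=
  forall (M N : lmodType A) (f : {linear M -> N})
    (MB NB : lmodType B) (etaM : {linear M -> MB | phi \; *:%R})
    (etaN : {linear N -> NB | phi \; *:%R}) (fB : {linear MB -> NB}),
    is_base_change etaM -> is_base_change etaN ->
    fB \o etaM =1 etaN \o f -> injective f -> injective fB.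

(* A polynomial in n variables over A is given as a list of terms
   (coefficient, exponents); this is its value at the point b of B^n. *)
Definition polyval (A B : comPzRingType) (phi : {rmorphism A -> B}) (n : nat)
  (f : seq (A * {ffun 'I_n -> nat})) (b : 'I_n -> B) : B :=
  \sum_(t <- f) phi t.1 * \prod_i b i ^+ t.2 i.

(* B = A[x_1, ..., x_n] / (f_1, ..., f_m), expressed by the universal property
   of the quotient, the images of the x_i being the b i *)
Definition finitely_presented (A B : comPzRingType) (phi : {rmorphism A -> B}) :=
  exists (n : nat) (b : 'I_n -> B) (fs : seq (seq (A * {ffun 'I_n -> nat}))),
    (forall f, f \in fs -> polyval phi f b = 0) /\
    forall (C : comPzRingType) (psi : {rmorphism A -> C}) (c : 'I_n -> C),
      (forall f, f \in fs -> polyval psi f c = 0) ->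
      exists2 h : {rmorphism B -> C}, h \o phi =1 psi /\ h \o b =1 c &
        forall h' : {rmorphism B -> C},
          h' \o phi =1 psi -> h' \o b =1 c -> h' =1 h.

Definition prime_ideal (A : comPzRingType) (P : A -> Prop) :=
  [/\ P 0 /\ ~ P 1,
      forall x y, P x -> P y -> P (x + y),
      forall a x, P x -> P (a * x)
    & forall x y, P (x * y) -> P x \/ P y].

(* finite families {Spec (B i) -> Spec A} *)
Definition fppf_cover (k : fieldType) (A : kalg k) (m : nat)
  (B : 'I_m -> kalg k) (s : forall i, khom A (B i)) :=
  [/\ forall i, flat (s i),
      forall i, finitely_presented (s i)
    & forall P : A -> Prop, prime_ideal P ->
        exists i (Q : B i -> Prop), prime_ideal Q /\ forall a, Q (s i a) <-> P a].

(* A category with a functor to affine k-schemes: ob A is the collection of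
   objects over Spec A, and mor y x consists of the arrows y -> x of the total
   category, lying over arbitrary maps Spec B -> Spec A.  Keeping all the arrows
   in one type (rather than one type for each A -> B) makes the category
   axioms plain equalities. *)
Record overcat (k : fieldType) := OverCat {
  ob :> kalg k -> Type;
  mor : forall A B : kalg k, ob B -> ob A -> Type;
  over : forall (A B : kalg k) (y : ob B) (x : ob A), mor y x -> khom A B;
  mid : forall (A : kalg k) (x : ob A), mor x x;
  mcomp : forall (A B C : kalg k) (x : ob A) (y : ob B) (z : ob C),
    mor y x -> mor z y -> mor z x;
  over_id : forall A (x : ob A), over (mid x) =1 id;
  over_comp : forall A B C (x : ob A) (y : ob B) (z : ob C)
    (f : mor y x) (g : mor z y), over (mcomp f g) =1 over g \o over f;
  mcomp1m : forall A B (x : ob A) (y : ob B) (f : mor y x), mcomp (mid x) f = f;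
  mcompm1 : forall A B (x : ob A) (y : ob B) (f : mor y x), mcomp f (mid y) = f;
  mcompA : forall A B C D (x : ob A) (y : ob B) (z : ob C) (w : ob D)
    (f : mor y x) (g : mor z y) (h : mor w z),
    mcomp f (mcomp g h) = mcomp (mcomp f g) h }.

Arguments mor {k o A B} y x.
Arguments over {k o A B y x} f.
Arguments mid {k o A} x.
Arguments mcomp {k o A B C x y z} f g.

Definition fibered_in_groupoids (k : fieldType) (X : overcat k) :=
  (forall (A B : kalg k) (f : khom A B) (x : X A),
     exists (y : X B) (g : mor y x), over g =1 f) /\
  (forall (A B C : kalg k) (x : X A) (y : X B) (z : X C)
     (f : mor y x) (g : mor z x) (h : khom B C),
     over g =1 h \o over f ->
     exists! l : mor z y, over l =1 h /\ mcomp f l = g).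

(* Isom presheaves are sheaves: arrows g i : x i -> x' defined on the members
   of a covering of x, and agreeing on the overlaps, glue to x -> x'. *)
Definition descent_for_arrows (k : fieldType) (X : overcat k) :=
  forall (A : kalg k) (m : nat) (B : 'I_m -> kalg k)
    (s : forall i, khom A (B i)), fppf_cover s ->
  forall (x x' : X A) (xi : forall i, X (B i))
    (f : forall i, mor (xi i) x) (g : forall i, mor (xi i) x'),
    (forall i, over (f i) =1 s i) -> (forall i, over (g i) =1 s i) ->
    (forall i j (D : kalg k) (y : X D) (p : mor y (xi i)) (q : mor y (xi j)),
       mcomp (f i) p = mcomp (f j) q -> mcomp (g i) p = mcomp (g j) q) ->
  exists! h : mor x x', over h =1 id /\ forall i, mcomp h (f i) = g i.

(* Descent data on objects xi i over Spec (B i).  The isomorphisms between the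
   two pullbacks of xi i and xi j to B i (x)_A B j are given by what they induce
   on D-points, i.e. for all B i -> D <- B j equal on A: for y -> xi i a
   pullback of xi i to D, the isomorphism from y to the pullback of xi j to D is
   the same thing as an arrow y -> xi j lying over b : B j -> D. *)
Record descent_datum (k : fieldType) (X : overcat k) (A : kalg k) (m : nat)
  (B : 'I_m -> kalg k) (s : forall i, khom A (B i)) := DescentDatum {
  dob :> forall i, X (B i);
  dglue : forall i j (D : kalg k) (y : X D) (p : mor y (dob i))
    (b : khom (B j) D), over p \o s i =1 b \o s j -> mor y (dob j);
  dglue_over : forall i j D (y : X D) (p : mor y (dob i)) (b : khom (B j) D)
    (e : over p \o s i =1 b \o s j), over (dglue e) =1 b;
  dglue_natural : forall i j D D' (y : X D) (y' : X D') (p : mor y (dob i))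
    (q : mor y' y) (b : khom (B j) D) (b' : khom (B j) D')
    (e : over p \o s i =1 b \o s j)
    (e' : over (mcomp p q) \o s i =1 b' \o s j),
    b' =1 over q \o b -> dglue e' = mcomp (dglue e) q;
  dglue_id : forall i D (y : X D) (p : mor y (dob i))
    (e : over p \o s i =1 over p \o s i), dglue e = p;
  dglue_cocycle : forall i j l D (y : X D) (p : mor y (dob i))
    (b : khom (B j) D) (c : khom (B l) D)
    (e : over p \o s i =1 b \o s j) (e' : over (dglue e) \o s j =1 c \o s l)
    (e'' : over p \o s i =1 c \o s l),
    dglue e' = dglue e'' }.

Definition descent_for_objects (k : fieldType) (X : overcat k) :=
  forall (A : kalg k) (m : nat) (B : 'I_m -> kalg k)
    (s : forall i, khom A (B i)), fppf_cover s ->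
  forall d : descent_datum X s,
  exists (x : X A) (f : forall i, mor (d i) x),
    (forall i, over (f i) =1 s i) /\
    forall i j D (y : X D) (p : mor y (d i)) (b : khom (B j) D)
      (e : over p \o s i =1 b \o s j),
      mcomp (f i) p = mcomp (f j) (dglue e).

Definition stack (k : fieldType) (X : overcat k) :=
  [/\ fibered_in_groupoids X, descent_for_arrows X & descent_for_objects X].

Definition locally_nonempty (k : fieldType) (X : overcat k) :=
  forall A : kalg k,
  exists (m : nat) (B : 'I_m -> kalg k) (s : forall i, khom A (B i)),
    fppf_cover s /\ forall i, inhabited (X (B i)).

Definition locally_connected (k : fieldType) (X : overcat k) :=
  forall (A : kalg k) (x y : X A),
  exists (m : nat) (B : 'I_m -> kalg k) (s : forall i, khom A (B i)),
    fppf_cover s /\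
    forall i, exists (z : X (B i)) (f : mor z x) (g : mor z y),
      over f =1 s i /\ over g =1 s i.

(* For x, y over Spec A, the sheaf Isom(x, y) is an affine A-scheme Spec H of
   finite presentation: (z, a, b) is the universal isomorphism between
   pullbacks of x and y.  This is how "algebraic" is expressed for the gerbes
   at hand: an algebraic gerbe whose geometric automorphism group schemes are
   finite constant has finite etale Isom schemes. *)
Definition isom_representable (k : fieldType) (X : overcat k) :=
  forall (A : kalg k) (x y : X A),
  exists (H : kalg k) (s : khom A H) (z : X H) (a : mor z x) (b : mor z y),
    [/\ finitely_presented s, over a =1 s, over b =1 s
      & forall (D : kalg k) (z' : X D) (a' : mor z' x) (b' : mor z' y),
          over a' =1 over b' ->
          exists! w : mor z' z, mcomp a w = a' /\ mcomp b w = b'].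

Definition gerbe (k : fieldType) (X : overcat k) :=
  [/\ stack X, locally_nonempty X, locally_connected X & isom_representable X].

(* Functors over affine k-schemes; between categories fibered in groupoids they
   automatically preserve cartesian arrows. *)
Record overfun (k : fieldType) (X Y : overcat k) := OverFun {
  fob :> forall A : kalg k, X A -> Y A;
  fmor : forall (A B : kalg k) (x : X A) (y : X B),
    mor y x -> mor (fob y) (fob x);
  fmor_over : forall A B (x : X A) (y : X B) (f : mor y x),
    over (fmor f) =1 over f;
  fmor_id : forall A (x : X A), fmor (mid x) = mid (fob x);
  fmor_comp : forall A B C (x : X A) (y : X B) (z : X C)
    (f : mor y x) (g : mor z y), fmor (mcomp f g) = mcomp (fmor f) (fmor g) }.

Arguments fmor {k X Y} o {A B x y} f.

Definition faithful (k : fieldType) (X Y : overcat k) (F : overfun X Y) :=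
  forall (A B : kalg k) (x : X A) (y : X B),
    injective (fmor F : mor y x -> mor (F B y) (F A x)).

(* Gm = Spec Z[u, v]/(uv - 1) *)
Definition Gm (R : comPzRingType) := {uv : R * R | uv.1 * uv.2 == 1}.

Definition gval (R : comPzRingType) (u : Gm R) : R := (val u).1.

Program Definition gone (R : comPzRingType) : Gm R :=
  exist _ (1, 1) _.
Next Obligation. by move=> R; rewrite /= mulr1. Qed.

Program Definition gmul (R : comPzRingType) (u v : Gm R) : Gm R :=
  exist _ ((val u).1 * (val v).1, (val u).2 * (val v).2) _.
Next Obligation.
by move=> R [[u u'] /= /eqP hu] [[v v'] /= /eqP hv]; rewrite /= mulrACA hu hv mulr1.
Qed.

Program Definition ginv (R : comPzRingType) (u : Gm R) : Gm R :=
  exist _ ((val u).2, (val u).1) _.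
Next Obligation. by move=> R [[u u'] /= hu]; rewrite /= mulrC. Qed.

Program Definition gmap (R S : comPzRingType) (f : {rmorphism R -> S})
  (u : Gm R) : Gm S := exist _ (f (val u).1, f (val u).2) _.
Next Obligation.
by move=> R S f [[u u'] /= /eqP hu]; rewrite /= -rmorphM hu rmorph1.
Qed.

(* A Gm-torsor over Spec A: an fppf sheaf on affine schemes over Spec A with a
   locally nonempty, simply transitive action of Gm.  As for overcat, tpt D is
   the set of all sections over Spec D -> Spec A, for varying A -> D = tbase. *)
Record torsor (k : fieldType) (A : kalg k) := Torsor {
  tpt :> kalg k -> Type;
  tbase : forall D : kalg k, tpt D -> khom A D;
  tres : forall D E : kalg k, khom D E -> tpt D -> tpt E;
  tact : forall D : kalg k, Gm D -> tpt D -> tpt D;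
  tbase_res : forall D E (h : khom D E) (t : tpt D),
    tbase (tres h t) =1 h \o tbase t;
  tres_id : forall D (t : tpt D), tres (kid D) t = t;
  tres_comp : forall D E E' (h' : khom E E') (h : khom D E) (t : tpt D),
    tres (kcomp h' h) t = tres h' (tres h t);
  tbase_act : forall (D : kalg k) (u : Gm D) (t : tpt D), tbase (tact u t) =1 tbase t;
  tact1 : forall D (t : tpt D), tact (gone D) t = t;
  tactM : forall (D : kalg k) (u v : Gm D) (t : tpt D),
    tact (gmul u v) t = tact u (tact v t);
  tres_act : forall (D E : kalg k) (h : khom D E) (u : Gm D) (t : tpt D),
    tres h (tact u t) = tact (gmap h u) (tres h t);
  tsheaf : forall (D : kalg k) (f : khom A D) (m : nat) (E : 'I_m -> kalg k)
    (s : forall i, khom D (E i)), fppf_cover s ->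
    forall t : forall i, tpt (E i),
      (forall i, tbase (t i) =1 s i \o f) ->
      (forall i j (C : kalg k) (a : khom (E i) C) (b : khom (E j) C),
         a \o s i =1 b \o s j -> tres a (t i) = tres b (t j)) ->
      exists! t0 : tpt D, tbase t0 =1 f /\ forall i, tres (s i) t0 = t i;
  tsimply_transitive : forall D (t t' : tpt D), tbase t =1 tbase t' ->
    exists! u : Gm D, tact u t = t';
  tlocally_nonempty : exists (m : nat) (E : 'I_m -> kalg k)
    (s : forall i, khom A (E i)),
    fppf_cover s /\ forall i, exists t : tpt (E i), tbase t =1 s i }.

Arguments tbase {k A} t {D} _ : rename.
Arguments tres {k A} t {D E} h _ : rename.
Arguments tact {k A} t {D} u _ : rename.

Record tmor (k : fieldType) (A B : kalg k) (T' : torsor B) (T : torsor A) := TMor {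
  tm_over : khom A B;
  tm_fun :> forall D : kalg k, T' D -> T D;
  tm_base : forall D (t : T' D), tbase T (tm_fun t) =1 tbase T' t \o tm_over;
  tm_res : forall D E (h : khom D E) (t : T' D),
    tm_fun (tres T' h t) = tres T h (tm_fun t);
  tm_act : forall (D : kalg k) (u : Gm D) (t : T' D),
    tm_fun (tact T' u t) = tact T u (tm_fun t) }.

Lemma tmor_eq (k : fieldType) (A B : kalg k) (T' : torsor B) (T : torsor A)
  (f g : tmor T' T) :
  tm_over f =1 tm_over g -> (forall D (t : T' D), f D t = g D t) -> f = g.
Proof.
case: f g => [f1 f2 f3 f4 f5] [g1 g2 g3 g4 g5] /= /khom_eq e1 fg.
case: g1 / e1 g3 => g3.
have e2 : f2 = g2 by apply: functional_extensionality_dep => D; apply: funext.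
case: g2 / e2 g3 g4 g5 {fg} => g3 g4 g5.
by rewrite (Prop_irrelevance f3 g3) (Prop_irrelevance f4 g4) (Prop_irrelevance f5 g5).
Qed.

Definition tmid (k : fieldType) (A : kalg k) (T : torsor A) : tmor T T :=
  @TMor k A A T T (kid A) (fun D t => t) (fun D t => frefl _)
    (fun D E h t => erefl) (fun D u t => erefl).

Program Definition tmcomp (k : fieldType) (A B C : kalg k) (T : torsor A)
  (T' : torsor B) (T'' : torsor C) (f : tmor T' T) (g : tmor T'' T') :
  tmor T'' T :=
  @TMor k A C T'' T (kcomp (tm_over g) (tm_over f)) (fun D t => f D (g D t)) _ _ _.
Next Obligation. by move=> *; move=> a; rewrite /= tm_base /= tm_base. Qed.
Next Obligation. by move=> *; rewrite /= !tm_res. Qed.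
Next Obligation. by move=> *; rewrite /= !tm_act. Qed.

Program Definition BGm (k : fieldType) : overcat k :=
  @OverCat k (@torsor k) (fun A B T' T => tmor T' T)
    (fun A B T' T f => tm_over f) (@tmid k) (@tmcomp k) _ _ _ _ _.
Next Obligation. by []. Qed.
Next Obligation. by []. Qed.
Next Obligation. by move=> *; apply: tmor_eq. Qed.
Next Obligation. by move=> *; apply: tmor_eq. Qed.
Next Obligation. by move=> *; apply: tmor_eq. Qed.

(* R-points, inside R, of the constant group scheme attached to a set G of
   elements of K, given K -> R: functions on Spec R which take the values
   z i, elements of G, on the members of a finite partition into open and closed
   pieces, given by idempotents. *)
Definition constant_point (K : fieldType) (G : {pred K}) (R : comPzRingType)
  (phi : K -> R) (h : R) :=
  exists (m : nat) (e : 'I_m -> R) (z : 'I_m -> K),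
    [/\ forall i, z i \in G,
        forall i j, e i * e j = if i == j then e i else 0,
        \sum_i e i = 1
      & h = \sum_i e i * phi (z i)].

(* Let p be over Spec A and t a section of F p, i.e. an isomorphism of F p with
   the trivial torsor.  The image of Aut(p) -> Aut(F p) = Gm on R-points:
   the automorphism a of the pullback p' of p acts as u. *)
Definition aut_image (k : fieldType) (X : overcat k) (F : overfun X (BGm k))
  (A : kalg k) (p : X A) (t : (F A p : torsor A) A) (R : kalg k) (f : khom A R)
  (u : Gm R) :=
  exists (p' : X R) (q : mor p' p) (a : mor p' p')
    (s : (F R p' : torsor R) R),
    [/\ over q =1 f, over a =1 id, tbase _ s =1 id,
        (fmor F q : tmor _ _) R s = tres _ f t
      & (fmor F a : tmor _ _) R s = tact _ u s].

Definition jgerbe (k0 : fieldType) (K : closedFieldType)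
  (iota : {rmorphism k0 -> K}) (G : {pred K}) (k : fieldType)
  (j : {rmorphism k0 -> k}) (X : overcat k) (F : overfun X (BGm k)) :=
  [/\ gerbe X, faithful F
    & exists (kbar : closedFieldType) (i : {rmorphism k -> kbar})
        (emb : {rmorphism K -> kbar}),
      [/\ forall x : kbar, algebraicOver i x,
          forall a : k0, emb (iota a) = i (j a)
        & exists (p : X (KAlg i)) (t : (F _ p : torsor (KAlg i)) (KAlg i))
            (c : Gm kbar),
            tbase _ t =1 id /\
            forall (R : kalg k) (f : khom (KAlg i) R) (u : Gm R),
              aut_image t f u <->
              exists g : Gm R,
                constant_point G (f \o emb) (gval g) /\
                u = gmul (gmul (gmap f c) g) (ginv (gmap f c))]].

Definition neutral (k0 : fieldType) (K : closedFieldType)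
  (iota : {rmorphism k0 -> K}) (G : {pred K}) :=
  forall (k : fieldType) (j : {rmorphism k0 -> k}) (X : overcat k)
    (F : overfun X (BGm k)), jgerbe iota G j F -> inhabited (X (kself k)).

Definition finite_mul_subgroup (K : fieldType) (G : {pred K}) :=
  [/\ 0 \notin G, 1 \in G, {in G &, forall x y, x * y \in G},
      {in G, forall x, x^-1 \in G} & exists s : seq K, G =i s].

Definition perfect (k : fieldType) :=
  forall f : {poly k}, irreducible_poly f -> separable_poly f.

Definition mu (K : fieldType) (n : nat) : {pred K} := n.-unity_root.
Arguments mu K n : clear implicits.

(* Main.v *)
(* A mark of an object x of the gerbe X over A is a trivialisation of the
   Gm-torsor F x.  An arrow between marked objects is determined by the map of
   bases and by the unit comparing the marks (F is faithful), and the
   automorphisms of a marked object are exactly the n-th roots of unity: this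
   holds over kbar by hypothesis, and descends from A (x)_k kbar to A because
   automorphism groups are affine schemes and k -> kbar has a linear retraction.
   Take a marked object m over a nonzero finitely presented k-algebra B.  Its
   two pullbacks to B (x)_k B are locally isomorphic, by a unit u well defined up
   to n-th roots of unity, so v = u^n is a global 1-cocycle with values in Gm;
   by Hilbert 90, v is the coboundary of a unit w of B.  After adjoining an n-th
   root y of w and multiplying the mark of m by y, the two pullbacks have unique
   isomorphisms respecting the marks.  These form a descent datum, and X is a
   stack, so X has an object over k.
   A finite subgroup G of the units of K is mu_n for n = #|G|, which is prime to
   the characteristic. *)

From HB Require Import structures.
From mathcomp Require Import all_boot all_order all_algebra all_field.
From mathcomp Require Import boolp classical_sets.
Require Import Defs.
Set Implicit Arguments.
Unset Strict Implicit.
Unset Printing Implicit Defensive.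
Import GRing.Theory.
Local Open Scope ring_scope.

(** * Tensor products and base change *)

(** The marked objects form the fibre product of X and Spec k over BGm. It is a torsor under
    Gm/mu_n, which the n-th power map identifies with Gm; Hilbert 90 trivialises this torsor. The
    proof handles the torsor only through its cocycle v. Two obstacles shape the details. In general
    kbar is not finitely presented over k, so that A -> A (x)_k kbar is not among the coverings for
    which X satisfies descent; a point of the affine scheme Isom, however, descends along any ring
    map with a linear retraction. Also, the ring B over which an object is found is merely a nonzero
    algebra, neither a field nor Galois over k, so that Hilbert 90 is proved with linear functionals
    in place of a Galois group. Finite presentation is carried along up to the last ring because its
    spectrum has to be an fppf covering of Spec k. *)

Section Tensor.
Variables (A : Type) (M N : zmodType) (l : A -> M -> M) (r : A -> N -> N).

(** Here [l] and [r] are bare functions, so that one construction serves both for pushouts of rings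
    and for base change of modules. *)
Definition balanced (Z : zmodType) (phi : M -> N -> Z) :=
  [/\ forall m m' n, phi (m + m') n = phi m n + phi m' n,
      forall m n n', phi m (n + n') = phi m n + phi m n'
    & forall a m n, phi (l a m) n = phi m (r a n)].

Definition tsum (Z : zmodType) (phi : M -> N -> Z) (s : seq (M * N)) : Z :=
  \sum_(p <- s) phi p.1 p.2.

(* The tensor product is defined by its universal property: formal sums are
   identified when all balanced maps agree on them. *)
Definition tens_eqv : rel (seq (M * N)) := fun s t =>
  `[< forall (Z : zmodType) (phi : M -> N -> Z),
        balanced phi -> tsum phi s = tsum phi t >].

Lemma tens_eqv_refl : reflexive tens_eqv.
Proof. by move=> s; apply/asboolP. Qed.

Lemma tens_eqv_sym : symmetric tens_eqv.
Proof. by move=> s t; apply/asboolP/asboolP => h Z phi hp; rewrite h. Qed.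

Lemma tens_eqv_trans : transitive tens_eqv.
Proof.
move=> s t u /asboolP h /asboolP h'; apply/asboolP => Z phi hp.
by rewrite h // h'.
Qed.

Canonical tens_equiv :=
  EquivRel tens_eqv tens_eqv_refl tens_eqv_sym tens_eqv_trans.

Definition tens := {eq_quot tens_eqv}%qT.
HB.instance Definition _ := Choice.on tens.

Definition tens_of (s : seq (M * N)) : tens := (\pi_tens s)%qT.
Definition ten (m : M) (n : N) : tens := tens_of [:: (m, n)].
Definition tlift (Z : zmodType) (phi : M -> N -> Z) (x : tens) : Z :=
  tsum phi (repr x)%qT.

Lemma tliftE (Z : zmodType) (phi : M -> N -> Z) s :
  balanced phi -> tlift phi (tens_of s) = tsum phi s.
Proof.
move=> hp; rewrite /tlift /tens_of.
have /eqmodP/asboolP -> // : (repr (\pi_tens s) = s %[mod tens])%qT by rewrite reprK.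
Qed.

Lemma tlift_ten (Z : zmodType) (phi : M -> N -> Z) m n :
  balanced phi -> tlift phi (ten m n) = phi m n.
Proof. by move=> hp; rewrite tliftE // /tsum big_seq1. Qed.

Lemma tensP (x y : tens) :
  (forall (Z : zmodType) (phi : M -> N -> Z), balanced phi ->
     tlift phi x = tlift phi y) -> x = y.
Proof.
move=> h; rewrite -[x]reprK -[y]reprK; apply/eqmodP/asboolP => Z phi hp.
exact: h.
Qed.

Lemma tsum_cat (Z : zmodType) (phi : M -> N -> Z) s t :
  tsum phi (s ++ t) = tsum phi s + tsum phi t.
Proof. exact: big_cat. Qed.

Section Balanced.
Variables (Z : zmodType) (phi : M -> N -> Z).
Hypothesis hp : balanced phi.

Lemma balanced0l n : phi 0 n = 0.
Proof. by case: hp => h _ _; apply: (addrI (phi 0 n)); rewrite -h !addr0. Qed.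

Lemma balanced0r m : phi m 0 = 0.
Proof. by case: hp => _ h _; apply: (addrI (phi m 0)); rewrite -h !addr0. Qed.

Lemma balancedNl m n : phi (- m) n = - phi m n.
Proof.
by case: hp => h _ _; apply/eqP; rewrite -addr_eq0 -h addNr balanced0l.
Qed.
End Balanced.

Definition tens_zero : tens := tens_of [::].
Definition tens_add (x y : tens) : tens := tens_of (repr x ++ repr y)%qT.
Definition tens_opp (x : tens) : tens :=
  tens_of [seq (- p.1, p.2) | p <- repr x]%qT.

Lemma tlift_add_subproof (Z : zmodType) (phi : M -> N -> Z) x y :
  balanced phi -> tlift phi (tens_add x y) = tlift phi x + tlift phi y.
Proof. by move=> hp; rewrite /tens_add tliftE // tsum_cat. Qed.

Lemma tlift_opp_subproof (Z : zmodType) (phi : M -> N -> Z) x :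
  balanced phi -> tlift phi (tens_opp x) = - tlift phi x.
Proof.
move=> hp; rewrite /tens_opp tliftE // /tlift /tsum big_map -sumrN.
by apply: eq_bigr => p _; rewrite (balancedNl hp).
Qed.

Lemma tlift_zero_subproof (Z : zmodType) (phi : M -> N -> Z) :
  balanced phi -> tlift phi tens_zero = 0.
Proof. by move=> hp; rewrite /tens_zero tliftE // /tsum big_nil. Qed.

Lemma tens_addA : associative tens_add.
Proof.
by move=> x y z; apply: tensP => Z phi hp; rewrite !tlift_add_subproof // addrA.
Qed.
Lemma tens_addC : commutative tens_add.
Proof.
by move=> x y; apply: tensP => Z phi hp; rewrite !tlift_add_subproof // addrC.
Qed.
Lemma tens_add0 : left_id tens_zero tens_add.
Proof.
move=> x; apply: tensP => Z phi hp.
by rewrite tlift_add_subproof // tlift_zero_subproof // add0r.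
Qed.
Lemma tens_addN : left_inverse tens_zero tens_opp tens_add.
Proof.
move=> x; apply: tensP => Z phi hp.
by rewrite tlift_add_subproof // tlift_zero_subproof // tlift_opp_subproof // addNr.
Qed.

HB.instance Definition _ :=
  GRing.isZmodule.Build tens tens_addA tens_addC tens_add0 tens_addN.

Lemma tlift_is_additive (Z : zmodType) (phi : M -> N -> Z) :
  balanced phi -> zmod_morphism (tlift phi).
Proof.
move=> hp x y.
by rewrite [LHS](tlift_add_subproof _ (- y)) // [tlift _ (- y)]tlift_opp_subproof.
Qed.

Lemma tliftD (Z : zmodType) (phi : M -> N -> Z) x y :
  balanced phi -> tlift phi (x + y) = tlift phi x + tlift phi y.
Proof. exact: tlift_add_subproof. Qed.

Lemma tlift0 (Z : zmodType) (phi : M -> N -> Z) :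
  balanced phi -> tlift phi 0 = 0.
Proof. exact: tlift_zero_subproof. Qed.

Lemma ten_balanced : balanced ten.
Proof.
split=> *; apply: tensP => Z phi hp; rewrite ?tliftD // !tlift_ten //; by case: hp.
Qed.

Lemma tens_sum (x : tens) : {s : seq (M * N) | x = \sum_(p <- s) ten p.1 p.2}.
Proof.
exists (repr x)%qT; apply: tensP => Z phi hp.
rewrite {1}/tlift /tsum.
elim: (repr x)%qT => [|p s IH]; first by rewrite !big_nil tlift0.
by rewrite !big_cons tliftD // tlift_ten // IH.
Qed.

Lemma tens_ext (Z : zmodType) (f g : tens -> Z) :
  zmod_morphism f -> zmod_morphism g ->
  (forall m n, f (ten m n) = g (ten m n)) -> f =1 g.
Proof.
move=> hf hg fg x; have [s ->] := tens_sum x.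
pose f' := GRing.isZmodMorphism.Build _ _ f hf.
pose g' := GRing.isZmodMorphism.Build _ _ g hg.
pose F : {additive tens -> Z} := HB.pack f f'.
pose G : {additive tens -> Z} := HB.pack g g'.
rewrite -[f]/(F : _ -> _) -[g]/(G : _ -> _) !raddf_sum.
by apply: eq_bigr => p _; apply: fg.
Qed.

End Tensor.

(** * Pushouts of commutative rings *)

Section Pushout.
Variables (A B C : comPzRingType) (f : {rmorphism A -> B}) (g : {rmorphism A -> C}).

Definition pushout := tens (fun a b => f a * b) (fun a c => g a * c).
HB.instance Definition _ := GRing.Zmodule.on pushout.

Definition pten (b : B) (c : C) : pushout := ten _ _ b c.
Local Notation bal := (balanced (fun a b => f a * b) (fun a c => g a * c)).

Definition pone : pushout := pten 1 1.
Definition pmul (x y : pushout) : pushout :=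
  tlift (fun b c => tlift (fun b' c' => pten (b * b') (c * c')) y) x.

Lemma bal_mul (Z : zmodType) (phi : B -> C -> Z) b c :
  bal phi -> bal (fun b' c' => phi (b * b') (c * c')).
Proof.
by case=> h1 h2 h3; split=> *; rewrite ?mulrDr // mulrCA h3 mulrCA.
Qed.

Lemma bal_lift (Z : zmodType) (phi : B -> C -> Z) (y : pushout) : bal phi ->
  bal (fun b c => tlift (fun b' c' => phi (b * b') (c * c')) y).
Proof.
case=> h1 h2 h3; split=> *; rewrite /tlift /tsum -?big_split;
  by apply: eq_bigr => p _; rewrite ?mulrDl // -!mulrA h3.
Qed.

(** By [tensP] an equation in the tensor product is tested on balanced maps; this formula computes
    them on products and so reduces the ring axioms to those of [B] and [C]. *)
Lemma pmul_lift (Z : zmodType) (phi : B -> C -> Z) (x y : pushout) : bal phi ->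
  tlift phi (pmul x y) =
  tlift (fun b c => tlift (fun b' c' => phi (b * b') (c * c')) y) x.
Proof.
move=> hp.
have bt : bal pten by apply: ten_balanced.
have hF := tlift_is_additive hp.
apply: (@tens_ext _ _ _ _ _ Z (fun x => tlift phi (pmul x y))
  (fun x : pushout =>
     tlift (fun b c => tlift (fun b' c' => phi (b * b') (c * c')) y) x)).
- move=> u v; rewrite /pmul [X in tlift phi X](_ : _ = pmul u y - pmul v y).
    by rewrite hF.
  by rewrite /pmul (tlift_is_additive (bal_lift y bt)).
- exact: (tlift_is_additive (bal_lift y hp)).
move=> b c; rewrite /pmul !tlift_ten; [|exact: bal_lift..].
apply: (@tens_ext _ _ _ _ _ Z
  (fun y : pushout => tlift phi (tlift (fun b' c' => pten (b * b') (c * c')) y))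
  (fun y : pushout => tlift (fun b' c' => phi (b * b') (c * c')) y)).
- move=> u v; rewrite (tlift_is_additive (bal_mul b c bt)) hF //.
- exact: (tlift_is_additive (bal_mul b c hp)).
by move=> b' c'; rewrite !tlift_ten //; apply: bal_mul.
Qed.

Lemma pmulA : associative pmul.
Proof.
move=> x y z; apply: tensP => Z phi hp.
rewrite !pmul_lift //; last exact: bal_lift.
rewrite /tlift /tsum; apply: eq_bigr => p _.
have := pmul_lift y z (bal_mul p.1 p.2 hp); rewrite {1}/tlift /tsum => ->.
rewrite /tlift /tsum; apply: eq_bigr => q _; apply: eq_bigr => s _.
by rewrite !mulrA.
Qed.

Lemma pmulC : commutative pmul.
Proof.
move=> x y; apply: tensP => Z phi hp; rewrite !pmul_lift // /tlift /tsum.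
rewrite exchange_big; apply: eq_bigr => p _; apply: eq_bigr => q _.
by rewrite mulrC [p.2 * _]mulrC.
Qed.

Lemma pmul1 : left_id pone pmul.
Proof.
move=> x; apply: tensP => Z phi hp; rewrite pmul_lift // tlift_ten.
  by rewrite /tlift /tsum; apply: eq_bigr => p _; rewrite !mul1r.
exact: bal_lift.
Qed.

Lemma pmulDl : left_distributive pmul +%R.
Proof.
move=> x y z; apply: tensP => Z phi hp.
rewrite tliftD // !pmul_lift // tliftD //; exact: bal_lift.
Qed.

HB.instance Definition _ :=
  GRing.Zmodule_isComPzRing.Build pushout pmulA pmulC pmul1 pmulDl.

Lemma pten_balanced : bal pten.
Proof. exact: ten_balanced. Qed.

Lemma ptenM b b' c c' : pten b c * pten b' c' = pten (b * b') (c * c').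
Proof.
rewrite -[LHS]/(pmul _ _) /pmul !tlift_ten //.
- exact/bal_mul/pten_balanced.
- exact/bal_lift/pten_balanced.
Qed.

Definition pinl (b : B) : pushout := pten b 1.
Definition pinr (c : C) : pushout := pten 1 c.

Lemma pinl_zmod : zmod_morphism pinl.
Proof.
case: pten_balanced => h _ _ x y; rewrite /pinl h.
by rewrite (balancedNl pten_balanced).
Qed.
Lemma pinl_monoid : monoid_morphism pinl.
Proof. by split=> // x y; rewrite ptenM mul1r. Qed.
Lemma pinr_zmod : zmod_morphism pinr.
Proof.
case: pten_balanced => _ h _ x y; apply/eqP.
by rewrite eq_sym subr_eq /pinr -h subrK.
Qed.
Lemma pinr_monoid : monoid_morphism pinr.
Proof. by split=> // x y; rewrite ptenM mul1r. Qed.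

HB.instance Definition _ := GRing.isZmodMorphism.Build B pushout pinl pinl_zmod.
HB.instance Definition _ := GRing.isMonoidMorphism.Build B pushout pinl pinl_monoid.
HB.instance Definition _ := GRing.isZmodMorphism.Build C pushout pinr pinr_zmod.
HB.instance Definition _ := GRing.isMonoidMorphism.Build C pushout pinr pinr_monoid.

Lemma ptenE b c : pten b c = pinl b * pinr c.
Proof. by rewrite ptenM mulr1 mul1r. Qed.

Lemma pinlr a : pinl (f a) = pinr (g a).
Proof.
by case: pten_balanced => _ _ h; rewrite /pinl -[f a]mulr1 h mulr1.
Qed.

Section Copair.
Variables (D : comPzRingType) (u : {rmorphism B -> D}) (v : {rmorphism C -> D}).
Hypothesis uv : forall a, u (f a) = v (g a).

Definition pcopair_map (x : pushout) : D := tlift (fun b c => u b * v c) x.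

Lemma bal_copair : bal (fun b c => u b * v c).
Proof.
split=> [b b' c|b c c'|a b c].
- by rewrite rmorphD mulrDl.
- by rewrite rmorphD mulrDr.
- by rewrite !rmorphM uv mulrCA mulrA.
Qed.

Lemma pcopair_zmod : zmod_morphism pcopair_map.
Proof. exact: (tlift_is_additive bal_copair). Qed.

Lemma pcopair_monoid : monoid_morphism pcopair_map.
Proof.
split; first by rewrite /pcopair_map tlift_ten ?rmorph1 ?mulr1 //; apply: bal_copair.
move=> x y; rewrite /pcopair_map pmul_lift; last exact: bal_copair.
rewrite /tlift /tsum mulr_suml; apply: eq_bigr => p _; rewrite mulr_sumr.
by apply: eq_bigr => q _; rewrite !rmorphM mulrACA.
Qed.

HB.instance Definition _ := GRing.isZmodMorphism.Build pushout D pcopair_map pcopair_zmod.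
HB.instance Definition _ := GRing.isMonoidMorphism.Build pushout D pcopair_map pcopair_monoid.
Definition pcopair : {rmorphism pushout -> D} := pcopair_map.

Lemma pcopair_pten b c : pcopair (pten b c) = u b * v c.
Proof. by rewrite /pcopair /= /pcopair_map tlift_ten //; apply: bal_copair. Qed.
Lemma pcopairl b : pcopair (pinl b) = u b.
Proof. by rewrite pcopair_pten rmorph1 mulr1. Qed.
Lemma pcopairr c : pcopair (pinr c) = v c.
Proof. by rewrite pcopair_pten rmorph1 mul1r. Qed.
End Copair.

End Pushout.

(** * Base change of modules *)

Section BaseChange.
Variables (A B : comPzRingType) (s : {rmorphism A -> B}) (M : lmodType A).

Definition bchg := tens (fun a (m : M) => a *: m) (fun a b => s a * b).
HB.instance Definition _ := GRing.Zmodule.on bchg.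
Local Notation bal := (balanced (fun a (m : M) => a *: m) (fun a b => s a * b)).

Definition bten (m : M) (b : B) : bchg := ten _ _ m b.
Lemma bten_balanced : bal bten. Proof. exact: ten_balanced. Qed.

Definition bscale (c : B) (x : bchg) : bchg := tlift (fun m b => bten m (c * b)) x.

Lemma bal_scale (Z : zmodType) (phi : M -> B -> Z) c :
  bal phi -> bal (fun m b => phi m (c * b)).
Proof. by case=> h1 h2 h3; split=> *; rewrite ?mulrDr // h3 mulrCA. Qed.

Lemma bscale_ten c m b : bscale c (bten m b) = bten m (c * b).
Proof. by rewrite /bscale tlift_ten //; apply/bal_scale/bten_balanced. Qed.

Lemma bscale_zmod c : zmod_morphism (bscale c).
Proof. exact: (tlift_is_additive (bal_scale c bten_balanced)). Qed.

Lemma bscaleA a b v : bscale a (bscale b v) = bscale (a * b) v.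
Proof.
apply: (@tens_ext _ _ _ _ _ _ (fun v => bscale a (bscale b v)) (bscale (a * b))).
- by move=> x y; rewrite !bscale_zmod.
- exact: bscale_zmod.
by move=> m c; rewrite !bscale_ten mulrA.
Qed.
Lemma bscale1 : left_id 1 bscale.
Proof.
apply: (@tens_ext _ _ _ _ _ _ (bscale 1) id) => //; first exact: bscale_zmod.
by move=> m b; rewrite bscale_ten mul1r.
Qed.
Lemma bscaleDr : right_distributive bscale +%R.
Proof.
move=> c x y; apply: tliftD; exact/bal_scale/bten_balanced.
Qed.
Lemma bscaleDl v : {morph bscale^~ v : a b / a + b}.
Proof.
move=> a b /=; apply: (@tens_ext _ _ _ _ _ _ (bscale (a + b))
  (fun v => bscale a v + bscale b v)).
- exact: bscale_zmod.
- by move=> x y; rewrite !bscale_zmod opprD addrACA.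
by move=> m c; rewrite !bscale_ten mulrDl; case: bten_balanced => _ ->.
Qed.

HB.instance Definition _ :=
  GRing.Zmodule_isLmodule.Build B bchg bscaleA bscale1 bscaleDr bscaleDl.

Definition beta (m : M) : bchg := bten m 1.

Lemma beta_zmod : zmod_morphism beta.
Proof.
case: bten_balanced => h _ _ x y; rewrite /beta h.
by rewrite (balancedNl bten_balanced).
Qed.
Lemma beta_scalable : scalable_for (s \; *:%R) beta.
Proof.
move=> a m; case: bten_balanced => _ _ h; rewrite /beta h /=.
by rewrite -[RHS]/(bscale (s a) (bten m 1)) bscale_ten.
Qed.
HB.instance Definition _ := GRing.isZmodMorphism.Build M bchg beta beta_zmod.
HB.instance Definition _ := GRing.isScalable.Build A M bchg (s \; *:%R) beta beta_scalable.

Lemma btenE m b : bten m b = b *: beta m.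
Proof. by rewrite -[RHS]/(bscale b (bten m 1)) bscale_ten mulr1. Qed.

Lemma bchg_ext (P : lmodType B) (u v : {linear bchg -> P}) :
  (forall m, u (beta m) = v (beta m)) -> u =1 v.
Proof.
move=> uv; apply: (@tens_ext _ _ _ _ _ P u v).
- by move=> x y; exact: raddfB.
- by move=> x y; exact: raddfB.
by move=> m b; rewrite -/(bten m b) btenE !linearZ_LR uv.
Qed.

Section Lift.
Variables (P : lmodType B) (g : {linear M -> P | s \; *:%R}).
Definition blift (x : bchg) : P := tlift (fun m b => b *: g m) x.
Lemma bal_blift : bal (fun m b => b *: g m).
Proof.
split=> *; rewrite ?raddfD ?scalerDr ?scalerDl //.
by rewrite linearZ /= scalerA mulrC.
Qed.
Lemma blift_zmod : zmod_morphism blift.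
Proof. exact: (tlift_is_additive bal_blift). Qed.
Lemma blift_ten m b : blift (bten m b) = b *: g m.
Proof. by rewrite /blift tlift_ten //; apply: bal_blift. Qed.
Lemma blift_scalable : scalable blift.
Proof.
move=> c x; apply: (@tens_ext _ _ _ _ _ P (fun x : bchg => blift (c *: x))
  (fun x : bchg => c *: blift x)).
- by move=> u v; rewrite scalerBr blift_zmod.
- by move=> u v; rewrite blift_zmod scalerBr.
move=> m b; rewrite -/(bten m b) -[c *: _]/(bscale c (bten m b)) bscale_ten !blift_ten.
by rewrite scalerA.
Qed.
HB.instance Definition _ := GRing.isZmodMorphism.Build bchg P blift blift_zmod.
HB.instance Definition _ := GRing.isScalable.Build B bchg P *:%R blift blift_scalable.
End Lift.

Lemma bchg_base_change : is_base_change (beta : {linear M -> bchg | s \; *:%R}).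
Proof.
move=> P g; exists (blift g : {linear bchg -> P}).
  by move=> m; rewrite /= blift_ten scale1r.
move=> h' hh'; apply: bchg_ext => m.
by rewrite [LHS]hh' [RHS]blift_ten scale1r.
Qed.

End BaseChange.

(** * Prime ideals and linear algebra by Zorn's lemma *)

Section Zorn.
Local Open Scope classical_set_scope.

Lemma Zorn_above (T : Type) (P : set (set T)) (X0 : set T) : P X0 ->
  (forall F : set (set T), F `<=` P -> F !=set0 -> total_on F subset ->
     P (\bigcup_(X in F) X)) ->
  exists A, [/\ X0 `<=` A, P A & forall B, A `<=` B -> P B -> B `<=` A].
Proof.
move=> PX0 Pchain.
(* Zorn is applied to the sets X such that X0 together with X satisfies [P]; the empty chain is then
   covered by the hypothesis on [X0]. *)
have [|A [PA Amax]] := @Zorn_bigcup T [set X | P (X0 `|` X)].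
  move=> F FP Ftot; have [[X FX]|F0] := pselect (F !=set0); last first.
    rewrite /= (_ : _ `|` _ = X0) //; apply/seteqP; split=> x; last by left.
    by case=> // -[X FX _]; case: F0; exists X.
  rewrite /= (_ : _ `|` _ = \bigcup_(Y in [set X0 `|` X | X in F]) Y).
    apply: Pchain.
    - by move=> _ [Y FY <-]; apply: FP.
    - by exists (X0 `|` X); exists X.
    - move=> _ _ [Y FY <-] [Z FZ <-].
      by have [h|h] := Ftot _ _ FY FZ; [left|right]; apply: setUS.
  apply/seteqP; split=> x.
    case=> [X0x|[Y FY Yx]]; first by exists (X0 `|` X); [exists X|left].
    by exists (X0 `|` Y); [exists Y|right].
  by case=> _ [Y FY <-] [X0x|Yx]; [left|right; exists Y].
exists (X0 `|` A); split=> //.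
move=> B AB PB x Bx.
have XB : X0 `|` B = B by apply/setUidPr => y X0y; apply: AB; left.
have [Ax|nAx] := pselect (A x); first by right.
exfalso; apply: (Amax B); last by rewrite /= XB.
split=> [y Ay|/(_ x Bx)]; last exact: nAx.
by apply: AB; right.
Qed.

End Zorn.

Definition ideal (A : comPzRingType) (I : A -> Prop) :=
  [/\ I 0, forall x y, I x -> I y -> I (x + y) & forall a x, I x -> I (a * x)].

Lemma idealB (A : comPzRingType) (I : A -> Prop) x y :
  ideal I -> I x -> I y -> I (x - y).
Proof.
by case=> _ hD hM Ix Iy; apply: hD => //; rewrite -mulN1r; apply: hM.
Qed.

Lemma prime_ideal_ideal (A : comPzRingType) (P : A -> Prop) :
  prime_ideal P -> ideal P.
Proof. by case=> -[]. Qed.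

Lemma exists_prime_above (A : comPzRingType) (I : A -> Prop) :
  ideal I -> ~ I 1 -> exists2 P, prime_ideal P & forall x, I x -> P x.
Proof.
move=> idI nI1.
pose ok (X : set A) := ideal X /\ ~ X 1.
have [|F|P [IP [idP nP1] Pmax]] := @Zorn_above A ok I; first by split.
  move=> Fok [X FX] Ftot; split; last by case=> Y /Fok [_ nY1] /nY1.
  split.
  - by exists X => //; have [[]] := Fok _ FX.
  - move=> x y [Y FY Yx] [Z FZ Zy].
    have [YZ|ZY] := Ftot _ _ FY FZ.
      by exists Z => //; have [[_ h _] _] := Fok _ FZ; apply: h => //; apply: YZ.
    by exists Y => //; have [[_ h _] _] := Fok _ FY; apply: h => //; apply: ZY.
  - by move=> a x [Y FY Yx]; exists Y => //; have [[_ _ h] _] := Fok _ FY; apply: h.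
have [P0 PD PM] := idP.
exists P => //; split=> // x y Pxy.
have [Px|nPx] := pselect (P x); [by left|right].
(* [Q] is the ideal generated by [P] and [x]. If it were proper, maximality of [P] would put [x] in
   [P]. *)
pose Q z := exists a, P (z - a * x).
have Q1 : Q 1.
  apply: contrapT => nQ1; apply: nPx; apply: (Pmax Q).
  - by move=> z Pz; exists 0; rewrite mul0r subr0.
  - split=> //; split.
    + by exists 0; rewrite mul0r subr0.
    + move=> u v [a ha] [b hb]; exists (a + b).
      by rewrite mulrDl opprD addrACA; apply: PD.
    + by move=> c u [a ha]; exists (c * a); rewrite -mulrA -mulrBr; apply: PM.
  - by exists 1; rewrite mul1r subrr.
have [a ha] := Q1.
have -> : y = y * (1 - a * x) + a * (x * y).
  by rewrite mulrBr mulr1 mulrCA [y * x]mulrC subrK.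
by apply: PD; apply: PM.
Qed.

(** * Complements and functionals in arbitrary dimension *)

Section LinearAlgebra.
Variables (k : fieldType) (V : lmodType k).

Definition subspace (W : V -> Prop) :=
  W 0 /\ forall a x y, W x -> W y -> W (a *: x + y).

Lemma subspaceD W x y : subspace W -> W x -> W y -> W (x + y).
Proof. by case=> _ h Wx Wy; rewrite -[x]scale1r; apply: h. Qed.

Lemma subspaceZ W a x : subspace W -> W x -> W (a *: x).
Proof. by case=> W0 h Wx; rewrite -[_ *: _]addr0; apply: h. Qed.

Lemma subspaceB W x y : subspace W -> W x -> W y -> W (x - y).
Proof.
by move=> hW Wx Wy; apply: subspaceD => //; rewrite -scaleN1r; apply: subspaceZ.
Qed.

(** A maximal subspace among those containing [W0] and meeting [U] in 0 is a complement: if [v] were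
    outside of U + W, the subspace W + k v would still meet [U] in 0. *)
Lemma exists_complement (U W0 : V -> Prop) : subspace U -> subspace W0 ->
  (forall x, U x -> W0 x -> x = 0) ->
  exists W, [/\ subspace W, forall x, W0 x -> W x,
    forall x, U x -> W x -> x = 0 & forall v, exists2 u, U u & W (v - u)].
Proof.
move=> sU sW0 UW0.
pose ok (X : set V) := subspace X /\ forall x, U x -> X x -> x = 0.
have [|F|W [W0W [sW UW] Wmax]] := @Zorn_above V ok W0; first by split.
  move=> Fok [X FX] Ftot; split; last first.
    by move=> x Ux [Y FY Yx]; have [_] := Fok _ FY; apply.
  split; first by exists X => //; have [[]] := Fok _ FX.
  move=> a x y [Y FY Yx] [Z FZ Zy].
  have [YZ|ZY] := Ftot _ _ FY FZ.
    by exists Z => //; have [[_ h] _] := Fok _ FZ; apply: h => //; apply: YZ.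
  by exists Y => //; have [[_ h] _] := Fok _ FY; apply: h => //; apply: ZY.
exists W; split=> // v; apply: contrapT => nv.
pose W' x := exists a, W (x - a *: v).
have W'v : W' v by exists 1; rewrite scale1r subrr; case: sW.
suff W'W : forall x, W' x -> W x.
  by apply: nv; exists 0; [case: sU|rewrite subr0; apply: W'W].
apply: Wmax.
  by move=> x Wx; exists 0; rewrite scale0r subr0.
split; first split.
- by exists 0; rewrite scale0r subrr; case: sW.
- move=> a x y [b hb] [c hc]; exists (a * b + c).
  rewrite scalerDl opprD addrACA -scalerA -scalerBr.
  by apply: subspaceD => //; apply: subspaceZ.
move=> x Ux [a ha]; have [a0|a0] := eqVneq a 0.
  by move: ha; rewrite a0 scale0r subr0; apply: UW.
case: nv; exists (a^-1 *: x); first exact: subspaceZ.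
have -> : v - a^-1 *: x = (- a^-1) *: (x - a *: v).
  by rewrite scalerBr !scaleNr scalerA mulVf // scale1r opprK addrC.
exact: subspaceZ.
Qed.

(** The functional is the coordinate along [a] with respect to a complement of the line k a that
    contains [W]. *)
Lemma exists_functional (W : V -> Prop) (a : V) : subspace W -> ~ W a ->
  exists lam : V -> k, [/\ forall c x y, lam (c *: x + y) = c * lam x + lam y,
    forall x, W x -> lam x = 0 & lam a = 1].
Proof.
move=> sW nWa.
pose U x := exists c, x = c *: a.
have sU : subspace U.
  split; first by exists 0; rewrite scale0r.
  move=> c x y [d ->] [e ->]; exists (c * d + e).
  by rewrite scalerA scalerDl.
have [x [c ->] Wca|W1 [sW1 WW1 UW1 dec]] := exists_complement sU sW.
  have [->|c0] := eqVneq c 0; first by rewrite scale0r.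
  case: nWa; rewrite -[a]scale1r -(mulVf c0) -scalerA; exact: subspaceZ.
have na : a != 0 by apply/eqP => a0; apply: nWa; rewrite a0; case: sW.
have dec' v : {c | W1 (v - c *: a)}.
  by apply: cid; have [_ [c ->] h] := dec v; exists c.
have uniq v c d : W1 (v - c *: a) -> W1 (v - d *: a) -> c = d.
  move=> hc hd; apply/eqP; rewrite -subr_eq0; apply/eqP.
  have : (c - d) *: a = 0.
    apply: UW1; first by exists (c - d).
    have -> : (c - d) *: a = (v - d *: a) - (v - c *: a).
      by rewrite scalerBl opprB addrC -addrA [RHS]addrC -!addrA addNr addr0.
    exact: subspaceB.
  by move/eqP; rewrite scaler_eq0 (negPf na) orbF => /eqP.
exists (fun v => sval (dec' v)); split.
- move=> c x y /=; apply: uniq (svalP (dec' _)) _.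
  rewrite scalerDl opprD addrACA -scalerA -scalerBr.
  apply: subspaceD => //; first by apply: subspaceZ => //; apply: (svalP (dec' x)).
  exact: (svalP (dec' y)).
- move=> x /WW1 Wx; apply: uniq (svalP (dec' _)) _.
  by rewrite scale0r subr0.
- by apply: uniq (svalP (dec' _)) _; rewrite scale1r subrr; case: sW1.
Qed.

End LinearAlgebra.

Lemma exists_retraction (k : fieldType) (M N : lmodType k) (f : {linear M -> N}) :
  injective f -> exists r : {linear N -> M}, forall x, r (f x) = x.
Proof.
move=> finj.
pose U y := exists x, y = f x.
have sU : subspace U.
  split; first by exists 0; rewrite raddf0.
  by move=> a _ _ [x ->] [y ->]; exists (a *: x + y); rewrite linearP.
have s0 : subspace (fun y : N => y = 0).
  by split=> // a x y -> ->; rewrite scaler0 addr0.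
have [//|W [sW _ UW dec]] := exists_complement sU s0.
have dec' y : {x | W (y - f x)}.
  by apply: cid; have [_ [x ->] h] := dec y; exists x.
have uniq y x x' : W (y - f x) -> W (y - f x') -> x = x'.
  move=> h h'; apply: finj; apply/eqP; rewrite -subr_eq0; apply/eqP.
  apply: UW; first by exists (x - x'); rewrite raddfB.
  have -> : f x - f x' = (y - f x') - (y - f x).
    by rewrite opprB addrC [RHS]addrC addrA subrK addrC.
  exact: subspaceB.
pose r y := sval (dec' y).
have rlin : linear r.
  move=> a x y; apply: uniq (svalP (dec' _)) _.
  rewrite linearP opprD addrACA -scalerBr.
  apply: subspaceD => //; first by apply: subspaceZ => //; apply: (svalP (dec' x)).
  exact: (svalP (dec' y)).
pose R : {linear N -> M} := HB.pack r (GRing.isLinear.Build _ _ _ _ r rlin).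
exists R => x; apply: uniq (svalP (dec' _)) _.
by rewrite subrr; case: sW.
Qed.

(** An injective linear map over a field has a linear retraction, and base change turns it into a
    retraction of [fB]. *)
Lemma flat_field (k : fieldType) (B : comPzRingType)
  (s : {rmorphism (k : comPzRingType) -> B}) : flat s.
Proof.
move=> M N f MB NB etaM etaN fB bcM bcN comm finj.
have [r rf] := exists_retraction finj.
have [rB hrB _] := bcN MB (etaM \o r : {linear N -> MB | s \; *:%R}).
have [h hh hu] := bcM MB etaM.
apply: (can_inj (g := rB)) => x.
rewrite -[LHS]/((rB \o fB : {linear MB -> MB}) x).
rewrite [LHS]hu; first by symmetry; rewrite -[LHS]/((idfun : {linear MB -> MB}) x); exact: hu.
move=> m; have := comm m; rewrite /= => ->; have := hrB (f m).
by rewrite /= rf.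
Qed.

(** * Finitely presented algebras *)

Section Polyval.
Variables (A B : comPzRingType) (phi : {rmorphism A -> B}) (n : nat) (b : 'I_n -> B).
Implicit Types f g : seq (A * {ffun 'I_n -> nat}).

Lemma polyval_cat f g : polyval phi (f ++ g) b = polyval phi f b + polyval phi g b.
Proof. exact: big_cat. Qed.

Definition poly_opp f := [seq (- t.1, t.2) | t <- f].

Lemma polyval_opp f : polyval phi (poly_opp f) b = - polyval phi f b.
Proof.
rewrite /polyval big_map -sumrN; apply: eq_bigr => t _.
by rewrite rmorphN mulNr.
Qed.

Definition term_mul (t u : A * {ffun 'I_n -> nat}) : A * {ffun 'I_n -> nat} :=
  (t.1 * u.1, [ffun i => (t.2 i + u.2 i)%N]).

Definition poly_mul f g := [seq term_mul t u | t <- f, u <- g].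

Lemma polyval_mul f g :
  polyval phi (poly_mul f g) b = polyval phi f b * polyval phi g b.
Proof.
rewrite /polyval /poly_mul big_allpairs_dep mulr_suml; apply: eq_bigr => t _.
rewrite mulr_sumr; apply: eq_bigr => u _.
rewrite rmorphM mulrACA; congr (_ * _); rewrite -big_split.
by apply: eq_bigr => i _; rewrite ffunE exprD.
Qed.

Definition poly_const (a : A) : seq (A * {ffun 'I_n -> nat}) := [:: (a, [ffun=> 0%N])].

Lemma polyval_const a : polyval phi (poly_const a) b = phi a.
Proof.
rewrite /polyval big_seq1 big1 ?mulr1 // => i _; by rewrite ffunE expr0.
Qed.

Definition poly_var (i : 'I_n) : seq (A * {ffun 'I_n -> nat}) :=
  [:: (1, [ffun j => (j == i : nat)])].

Lemma polyval_var i : polyval phi (poly_var i) b = b i.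
Proof.
rewrite /polyval big_seq1 rmorph1 mul1r (bigD1 i) //= ffunE eqxx expr1.
rewrite big1 ?mulr1 // => j ji; by rewrite ffunE (negPf ji) expr0.
Qed.

End Polyval.

Lemma polyval_comp (A B C : comPzRingType) (phi : {rmorphism A -> B})
  (h : {rmorphism B -> C}) (psi : {rmorphism A -> C}) n f (b : 'I_n -> B)
  (c : 'I_n -> C) :
  h \o phi =1 psi -> h \o b =1 c -> h (polyval phi f b) = polyval psi f c.
Proof.
move=> hphi hb; rewrite /polyval rmorph_sum; apply: eq_bigr => t _.
rewrite rmorphM rmorph_prod -[psi _]hphi; congr (_ * _).
by apply: eq_bigr => i _; rewrite rmorphXn -hb.
Qed.

Section Presented.
Variables (A : comPzRingType) (n : nat) (fs : seq (seq (A * {ffun 'I_n -> nat}))).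
Local Notation term := (seq (A * {ffun 'I_n -> nat})).

Definition fpmodel (C : comPzRingType) (psi : {rmorphism A -> C}) (c : 'I_n -> C) :=
  forall f, f \in fs -> polyval psi f c = 0.

(* As for the tensor product: A[x_1, ..., x_n] / (fs) consists of the
   polynomial expressions, two of them being identified when they have the
   same value at all solutions of fs in all A-algebras. *)
Definition fpeqv : rel term := fun s t =>
  `[< forall (C : comPzRingType) (psi : {rmorphism A -> C}) (c : 'I_n -> C),
        fpmodel psi c -> polyval psi s c = polyval psi t c >].

Lemma fpeqv_refl : reflexive fpeqv.
Proof. by move=> s; apply/asboolP. Qed.
Lemma fpeqv_sym : symmetric fpeqv.
Proof. by move=> s t; apply/asboolP/asboolP => h C psi c hc; rewrite h. Qed.
Lemma fpeqv_trans : transitive fpeqv.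
Proof.
move=> s t u /asboolP h /asboolP h'; apply/asboolP => C psi c hc.
by rewrite h // h'.
Qed.

Canonical fp_equiv := EquivRel fpeqv fpeqv_refl fpeqv_sym fpeqv_trans.
Definition fpring := {eq_quot fpeqv}%qT.
HB.instance Definition _ := Choice.on fpring.

Definition fpof (s : term) : fpring := (\pi_fpring s)%qT.
Definition fpeval (C : comPzRingType) (psi : {rmorphism A -> C}) (c : 'I_n -> C)
  (x : fpring) : C := polyval psi (repr x)%qT c.

Lemma fpevalE (C : comPzRingType) (psi : {rmorphism A -> C}) c s :
  fpmodel psi c -> fpeval psi c (fpof s) = polyval psi s c.
Proof.
move=> hc; rewrite /fpeval /fpof.
have /eqmodP/asboolP -> // : (repr (\pi_fpring s) = s %[mod fpring])%qT by rewrite reprK.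
Qed.

Lemma fpP (x y : fpring) :
  (forall (C : comPzRingType) (psi : {rmorphism A -> C}) (c : 'I_n -> C),
     fpmodel psi c -> fpeval psi c x = fpeval psi c y) -> x = y.
Proof.
move=> h; rewrite -[x]reprK -[y]reprK; apply/eqmodP/asboolP => C psi c hc.
exact: h.
Qed.

Definition fpadd (x y : fpring) := fpof (repr x ++ repr y)%qT.
Definition fpopp (x : fpring) := fpof (poly_opp (repr x)%qT).
Definition fpmul (x y : fpring) := fpof (poly_mul (repr x)%qT (repr y)%qT).
Definition fpconst (a : A) := fpof (poly_const n a).
Definition fpvar (i : 'I_n) := fpof (poly_var A i).

Section Eval.
Variables (C : comPzRingType) (psi : {rmorphism A -> C}) (c : 'I_n -> C).
Hypothesis hc : fpmodel psi c.
Lemma fpeval_add x y : fpeval psi c (fpadd x y) = fpeval psi c x + fpeval psi c y.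
Proof. by rewrite fpevalE // polyval_cat. Qed.
Lemma fpeval_opp x : fpeval psi c (fpopp x) = - fpeval psi c x.
Proof. by rewrite fpevalE // polyval_opp. Qed.
Lemma fpeval_mul x y : fpeval psi c (fpmul x y) = fpeval psi c x * fpeval psi c y.
Proof. by rewrite fpevalE // polyval_mul. Qed.
Lemma fpeval_const a : fpeval psi c (fpconst a) = psi a.
Proof. by rewrite fpevalE // polyval_const. Qed.
Lemma fpeval_var i : fpeval psi c (fpvar i) = c i.
Proof. by rewrite fpevalE // polyval_var. Qed.
End Eval.

Definition fpE := (fpeval_add, fpeval_opp, fpeval_mul, fpeval_const, fpeval_var).

Lemma fpaddA : associative fpadd.
Proof. by move=> x y z; apply: fpP => C psi c hc; rewrite !fpE // addrA. Qed.
Lemma fpaddC : commutative fpadd.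
Proof. by move=> x y; apply: fpP => C psi c hc; rewrite !fpE // addrC. Qed.
Lemma fpadd0 : left_id (fpconst 0) fpadd.
Proof. by move=> x; apply: fpP => C psi c hc; rewrite !fpE // rmorph0 add0r. Qed.
Lemma fpaddN : left_inverse (fpconst 0) fpopp fpadd.
Proof. by move=> x; apply: fpP => C psi c hc; rewrite !fpE // rmorph0 addNr. Qed.
Lemma fpmulA : associative fpmul.
Proof. by move=> x y z; apply: fpP => C psi c hc; rewrite !fpE // mulrA. Qed.
Lemma fpmulC : commutative fpmul.
Proof. by move=> x y; apply: fpP => C psi c hc; rewrite !fpE // mulrC. Qed.
Lemma fpmul1 : left_id (fpconst 1) fpmul.
Proof. by move=> x; apply: fpP => C psi c hc; rewrite !fpE // rmorph1 mul1r. Qed.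
Lemma fpmulDl : left_distributive fpmul fpadd.
Proof. by move=> x y z; apply: fpP => C psi c hc; rewrite !fpE // mulrDl. Qed.

HB.instance Definition _ := GRing.isZmodule.Build fpring fpaddA fpaddC fpadd0 fpaddN.
HB.instance Definition _ :=
  GRing.Zmodule_isComPzRing.Build fpring fpmulA fpmulC fpmul1 fpmulDl.

Lemma fpconst_zmod : zmod_morphism fpconst.
Proof.
move=> x y; apply: fpP => C psi c hc.
by rewrite -[fpconst x - _]/(fpadd _ (fpopp _)) !fpE // rmorphB.
Qed.
Lemma fpconst_monoid : monoid_morphism fpconst.
Proof.
split=> // x y; apply: fpP => C psi c hc.
by rewrite -[fpconst x * _]/(fpmul _ _) !fpE // rmorphM.
Qed.
HB.instance Definition _ := GRing.isZmodMorphism.Build A fpring fpconst fpconst_zmod.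
HB.instance Definition _ := GRing.isMonoidMorphism.Build A fpring fpconst fpconst_monoid.

Section EvalMorphism.
Variables (C : comPzRingType) (psi : {rmorphism A -> C}) (c : 'I_n -> C).
Hypothesis hc : fpmodel psi c.
Lemma fpeval_is_zmod : zmod_morphism (fpeval psi c).
Proof. by move=> x y; rewrite -[x - y]/(fpadd x (fpopp y)) !fpE. Qed.
Lemma fpeval_is_monoid : monoid_morphism (fpeval psi c).
Proof.
split; first by rewrite -[1]/(fpconst 1) !fpE // rmorph1.
by move=> x y; rewrite -[x * y]/(fpmul x y) !fpE.
Qed.
Definition fpeval_morph : {rmorphism fpring -> C} :=
  HB.pack (fpeval psi c)
    (GRing.isZmodMorphism.Build _ _ (fpeval psi c) fpeval_is_zmod)
    (GRing.isMonoidMorphism.Build _ _ (fpeval psi c) fpeval_is_monoid).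
End EvalMorphism.

Lemma fpofE s : fpof s = polyval fpconst s fpvar.
Proof.
apply: fpP => C psi c hc; rewrite fpevalE //.
symmetry; apply: (@polyval_comp _ _ _ _ (fpeval_morph hc) psi) => [a|i];
  by rewrite /= !fpE.
Qed.

Lemma fp_model : fpmodel fpconst fpvar.
Proof.
move=> f ffs; rewrite -fpofE; apply: fpP => C psi c hc.
by rewrite fpevalE // hc // -[RHS]/(fpeval psi c (fpconst 0)) fpeval_const // rmorph0.
Qed.

Lemma fp_finitely_presented : finitely_presented fpconst.
Proof.
exists n, fpvar, fs; split; first exact: fp_model.
move=> C psi c hc; exists (fpeval_morph hc).
  by split=> [a|i]; rewrite /= !fpE.
move=> h' h1 h2 x; rewrite -[x]reprK -/(fpof _) fpofE.
rewrite (polyval_comp _ h1 h2); symmetry.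
by apply: (@polyval_comp _ _ _ _ (fpeval_morph hc) psi) => [a|i]; rewrite /= !fpE.
Qed.

End Presented.

(** The universal property gives a map from [B] to the formal model [fpring]; followed by evaluation
    at [b], it is the identity by uniqueness. A representative in the model is the required
    polynomial. *)
Lemma fp_generated (A B : comPzRingType) (phi : {rmorphism A -> B}) n b fs :
  fpmodel fs phi b ->
  (forall (C : comPzRingType) (psi : {rmorphism A -> C}) (c : 'I_n -> C),
      fpmodel fs psi c ->
      exists2 h : {rmorphism B -> C}, h \o phi =1 psi /\ h \o b =1 c &
        forall h' : {rmorphism B -> C},
          h' \o phi =1 psi -> h' \o b =1 c -> h' =1 h) ->
  forall x, {q | x = polyval phi q b}.
Proof.
move=> hb univ x; apply: cid.
have [h [h1 h2] _] := univ _ _ _ (@fp_model A n fs).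
have [g [g1 g2] gu] := univ _ _ _ hb.
pose e := fpeval_morph hb.
exists (repr (h x))%qT; rewrite -[RHS]/(e (h x)).
rewrite -[LHS]/((idfun : {rmorphism B -> B}) x) [LHS]gu //.
rewrite -[RHS]/((e \o h : {rmorphism B -> B}) x) [RHS]gu // => [a|i] /=.
  by have /= -> := h1 a; rewrite /e /= !fpE.
by have /= -> := h2 i; rewrite /e /= !fpE.
Qed.

(** The generators of [B] and of [C] are put together. The relations are those of [B] and those of
    [C], the coefficients of the latter being written as polynomials in the generators of [B]. *)
Lemma finitely_presented_comp (A B C : comPzRingType) (f : {rmorphism A -> B})
  (g : {rmorphism B -> C}) (gf : {rmorphism A -> C}) : gf =1 g \o f ->
  finitely_presented f -> finitely_presented g -> finitely_presented gf.
Proof.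
move=> gfE [n [b [fs [hb univb]]]] [m [c [gs [hc univc]]]].
have gen := fp_generated hb univb.
pose ext (e : {ffun 'I_n -> nat}) (e' : {ffun 'I_m -> nat}) :
    {ffun 'I_(n + m) -> nat} :=
  [ffun i => match split i with inl j => e j | inr j => e' j end].
pose up1 (s : seq (A * {ffun 'I_n -> nat})) := [seq (t.1, ext t.2 [ffun=> 0%N]) | t <- s].
(* Each coefficient in [B] is replaced by the polynomial over [A] that [gen] chooses for it. *)
pose up (s : seq (B * {ffun 'I_m -> nat})) : seq (A * {ffun 'I_(n + m) -> nat}) :=
  flatten [seq [seq (u.1, ext u.2 t.2) | u <- sval (gen t.1)] | t <- s].
have extE (D : comPzRingType) (d : 'I_(n + m) -> D) e e' :
    \prod_i d i ^+ ext e e' i =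
    (\prod_i d (lshift m i) ^+ e i) * \prod_i d (rshift n i) ^+ e' i.
  rewrite big_split_ord; congr (_ * _); apply: eq_bigr => i _; rewrite ffunE.
    by case: split_ordP => j /eqP; rewrite ?eq_lshift ?eq_lrshift // => /eqP ->.
  by case: split_ordP => j /eqP; rewrite ?eq_rshift ?eq_rlshift // => /eqP ->.
have up1E (D : comPzRingType) (th : {rmorphism A -> D}) (d : 'I_(n + m) -> D) s :
    polyval th (up1 s) d = polyval th s (d \o lshift m).
  rewrite /polyval big_map; apply: eq_bigr => t _; rewrite extE.
  by rewrite [X in _ * (_ * X)]big1 ?mulr1 // => i _; rewrite ffunE expr0.
have upE (D : comPzRingType) (th : {rmorphism A -> D}) (h : {rmorphism B -> D})
    (d : 'I_(n + m) -> D) s : h \o f =1 th -> h \o b =1 d \o lshift m ->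
    polyval th (up s) d = polyval h s (d \o @rshift n m).
  move=> hf hb'; rewrite /polyval /up big_flatten big_map; apply: eq_bigr => t _.
  rewrite big_map [in RHS](svalP (gen t.1)) (polyval_comp _ hf hb') mulr_suml.
  by apply: eq_bigr => u _; rewrite extE mulrA.
pose cc i := match split i with inl j => g (b j) | inr j => c j end.
have ccl i : cc (lshift m i) = g (b i).
  by rewrite /cc; case: split_ordP => j /eqP; rewrite ?eq_lshift ?eq_lrshift // => /eqP ->.
have ccr i : cc (rshift n i) = c i.
  by rewrite /cc; case: split_ordP => j /eqP; rewrite ?eq_rshift ?eq_rlshift // => /eqP ->.
exists (n + m)%N, cc, (map up1 fs ++ map up gs); split.
  move=> p; rewrite mem_cat => /orP[] /mapP[q qs ->].
    rewrite up1E -(@polyval_comp _ _ _ f g gf n q b (cc \o lshift m)) ?hb ?rmorph0 //.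
      by move=> i; rewrite /= ccl.
  rewrite (upE C gf g cc q (fun a => esym (gfE a)) (fun i => esym (ccl i))).
  rewrite -[RHS](hc q) //; apply: eq_bigr => t _; congr (_ * _).
  by apply: eq_bigr => i _; rewrite /= ccr.
move=> D th d hd.
have [|h [h1 h2] hu] := univb D th (d \o lshift m).
  by move=> q qfs; rewrite -up1E; apply: hd; rewrite mem_cat map_f.
have [|h' [h1' h2'] hu'] := univc D h (d \o @rshift n m).
  move=> q qgs; rewrite -(upE _ th) //; apply: hd.
  by rewrite mem_cat (map_f up qgs) orbT.
exists h'.
  split=> [a|i]; first by rewrite /= gfE /= -h1; exact: h1'.
  rewrite /= /cc -{2}[i]splitK; case: (split i) => j /=; last exact: h2'.
  by have /= -> := h1' (b j); exact: h2.
move=> h'' e1 e2; apply: hu'.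
  apply: (hu (h'' \o g)) => [a|i] /=; first by rewrite -[g (f a)]gfE; exact: e1.
  by rewrite -ccl; apply: e2.
by move=> i; rewrite /= -ccr; apply: e2.
Qed.

(** * Faithful flatness *)

(** A copy of [R] that records [chi] in its type, so that the [A]-module structure obtained by
    restriction of scalars can be attached to it. *)
Definition restr_of (A R : comPzRingType) (chi : {rmorphism A -> R}) : Type := R.

Section Restriction.
Variables (A R : comPzRingType) (chi : {rmorphism A -> R}).
Local Notation restr := (restr_of chi).
HB.instance Definition _ := GRing.Zmodule.on restr.

Definition restr_scale (a : A) (x : restr) : restr := chi a * (x : R).
Lemma restr_scaleA a b v : restr_scale a (restr_scale b v) = restr_scale (a * b) v.
Proof. by rewrite /restr_scale rmorphM mulrA. Qed.
Lemma restr_scale1 : left_id 1 restr_scale.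
Proof. by move=> x; rewrite /restr_scale rmorph1 mul1r. Qed.
Lemma restr_scaleDr : right_distributive restr_scale +%R.
Proof. by move=> a x y; rewrite /restr_scale -mulrDr. Qed.
Lemma restr_scaleDl v : {morph restr_scale^~ v : a b / a + b}.
Proof. by move=> a b; rewrite /restr_scale rmorphD mulrDl. Qed.
HB.instance Definition _ := GRing.Zmodule_isLmodule.Build A restr
  restr_scaleA restr_scale1 restr_scaleDr restr_scaleDl.

Section Cyclic.
Variable z : R.
Definition cyclic_pred : {pred restr} := fun y => `[< exists a, y = chi a * z >].
Lemma cyclic_closed : submod_closed cyclic_pred.
Proof.
split; first by apply/asboolP; exists 0; rewrite rmorph0 mul0r.
move=> a _ _ /asboolP[b ->] /asboolP[c ->]; apply/asboolP; exists (a * b + c).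
by rewrite rmorphD rmorphM mulrDl -mulrA.
Qed.
HB.instance Definition _ := GRing.isSubmodClosed.Build A restr cyclic_pred cyclic_closed.
Definition cyclic := {y : restr | y \in cyclic_pred}.
HB.instance Definition _ := SubChoice.on cyclic.
HB.instance Definition _ := [SubChoice_isSubLmodule of cyclic by <:].
End Cyclic.
End Restriction.

Section QuotientByIdeal.
Variables (B : comPzRingType) (Q : B -> Prop).
Hypothesis idQ : ideal Q.
Definition ideal_pred : {pred B} := fun x => `[< Q x >].
Lemma ideal_pred_closed : zmod_closed ideal_pred.
Proof.
split; first by apply/asboolP; case: idQ.
by move=> x y /asboolP Qx /asboolP Qy; apply/asboolP/(idealB idQ).
Qed.
Definition ideal_closed : zmodClosed B :=
  HB.pack ideal_pred (GRing.isZmodClosed.Build B ideal_pred ideal_pred_closed).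
(** Only the additive group is formed, because it serves as the target of a balanced map. *)
Definition quotient : zmodType := Quotient.quot ideal_closed.
Definition qclass (x : B) : quotient := (\pi_quotient x)%qT.
Lemma qclass_eq x y : qclass x = qclass y <-> Q (x - y).
Proof.
rewrite /qclass; split=> [/eqP|Qxy].
  by rewrite -Quotient.idealrBE => /asboolP.
by apply/eqP; rewrite -Quotient.idealrBE; apply/asboolP.
Qed.
Lemma qclassD x y : qclass (x + y) = qclass x + qclass y.
Proof. by rewrite /qclass piE. Qed.
End QuotientByIdeal.

(* Faithful flatness of a covering, universally: an element z of R vanishing
   over all B i vanishes.  Otherwise a prime P contains the annihilator of z
   and lifts to a prime of some B i, while the base change of A z is
   generated by 1 (x) z = 0. *)
Lemma cover_separated (k : fieldType) (A : kalg k) m (B : 'I_m -> kalg k)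
  (s : forall i, khom A (B i)) (R : comPzRingType) (chi : {rmorphism A -> R}) (z : R) :
  fppf_cover s -> (forall i, pinl chi (s i) z = 0) -> z = 0.
Proof.
move=> [flats _ lifts] z0; apply: contrapT => nz.
pose I a := chi a * z = 0.
have idI : ideal I.
  split; rewrite /I; first by rewrite rmorph0 mul0r.
  - by move=> x y hx hy; rewrite rmorphD mulrDl hx hy addr0.
  - by move=> a x hx; rewrite rmorphM -mulrA hx mulr0.
have [|P prP IP] := exists_prime_above idI; first by rewrite /I rmorph1 mul1r.
have [i [Q [prQ QP]]] := lifts P prP.
have idQ := prime_ideal_ideal prQ.
have zin : (z : restr_of chi) \in @cyclic_pred _ _ chi z.
  by apply/asboolP; exists 1; rewrite rmorph1 mul1r.
pose M := cyclic chi z; pose z' : M := exist _ (z : restr_of chi) zin.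
pose f : {linear M -> restr_of chi} := val.
pose fB : {linear bchg (s i) M -> bchg (s i) (restr_of chi)} :=
  blift (@beta _ _ (s i) (restr_of chi) \o f : {linear M -> bchg (s i) (restr_of chi) | s i \; *:%R}).
have finj : injective fB.
  apply: (flats i _ _ f _ _ (@beta _ _ (s i) M) (@beta _ _ (s i) (restr_of chi)));
    [exact: bchg_base_change|exact: bchg_base_change| |exact: val_inj].
  by move=> y; rewrite /= blift_ten scale1r.
(* By flatness, A z (x) B i embeds into R (x) B i. The latter is, up to conversion, the pushout in
   which z (x) 1 vanishes by hypothesis. *)
have b0 : beta (s i) z' = 0.
  apply: finj; rewrite raddf0 [LHS]blift_ten scale1r; exact: z0 i.
have rep (y : M) : {a : A | val y = chi a * z}.
  by apply: cid; case: y => y /= /asboolP.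
have repu (a b : A) : chi a * z = chi b * z -> Q (s i (a - b)).
  move=> ab; apply/QP/IP; by rewrite /I rmorphB mulrBl ab subrr.
(* The map a z (x) b |-> s_i(a) b from A z (x) B i to B i / Q is well defined because the
   annihilator of [z] lies in [P]. It sends z (x) 1 to the class of 1, which is nonzero. *)
pose psi (y : M) (b : B i) := qclass idQ (s i (sval (rep y)) * b).
have [Q0 QD QM] := idQ.
have bal : balanced (fun a (y : M) => a *: y) (fun a b => s i a * b) psi.
  split=> [y y' b|y b b'|a y b]; rewrite /psi /= -?qclassD.
  - apply/qclass_eq; rewrite -mulrDl -mulrBl mulrC -rmorphD -rmorphB.
    apply: QM; apply: repu; rewrite -(svalP (rep _)) rmorphD mulrDl.
    by rewrite -!(svalP (rep _)).
  - by rewrite mulrDr.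
  - apply/qclass_eq; rewrite mulrA -rmorphM -mulrBl -rmorphB mulrC.
    apply: QM; apply: repu; rewrite -(svalP (rep _)) [_ * a]mulrC rmorphM -mulrA.
    by rewrite -(svalP (rep _)).
have /qclass_eq : qclass idQ (s i (sval (rep z')) * 1) = qclass idQ 0.
  rewrite -[LHS](tlift_ten z' 1 bal) -[ten _ _ _ _]/(beta (s i) z') b0.
  rewrite tlift0 //; apply: (addrI (qclass idQ 0)).
  by rewrite -qclassD !addr0.
rewrite subr0 mulr1 => Qz.
have Q1 : Q (s i (1 - sval (rep z'))).
  by apply: repu; rewrite rmorph1 mul1r -(svalP (rep z')).
have [[_ nQ1] _ _ _] := prQ; apply: nQ1.
by rewrite -(rmorph1 (s i)) -(subrK (sval (rep z')) 1) rmorphD; apply: QD.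
Qed.

(** * Hilbert 90 *)

Section FieldPushout.
Variables (k : fieldType) (B C : comPzRingType).
Variables (f : {rmorphism k -> B}) (g : {rmorphism k -> C}).

Definition klinear (lam : B -> k) :=
  forall c x y, lam (f c * x + y) = c * lam x + lam y.

Lemma klinear0 lam : klinear lam -> lam 0 = 0.
Proof.
by move=> /(_ (-1) 0 0); rewrite mulr0 addr0 mulN1r addNr.
Qed.
Lemma klinearD lam x y : klinear lam -> lam (x + y) = lam x + lam y.
Proof. by move=> /(_ 1 x y); rewrite rmorph1 !mul1r. Qed.
Lemma klinearZ lam c x : klinear lam -> lam (f c * x) = c * lam x.
Proof. by move=> h; have := h c x 0; rewrite (klinear0 h) !addr0. Qed.

Lemma exists_klinear (W : B -> Prop) (a : B) :
  W 0 -> (forall c x y, W x -> W y -> W (f c * x + y)) -> ~ W a ->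
  exists lam, [/\ klinear lam, forall x, W x -> lam x = 0 & lam a = 1].
Proof.
by move=> W0 WD nWa; apply: (@exists_functional k (restr_of f) W a).
Qed.

Definition contract (lam : B -> k) (x : pushout f g) : C :=
  tlift (fun b c => g (lam b) * c) x.

Section Contract.
Variable lam : B -> k.
Hypothesis hlam : klinear lam.

Lemma contract_bal :
  balanced (fun a b => f a * b) (fun a c => g a * c) (fun b c => g (lam b) * c).
Proof.
split=> [x y c|x c d|a b c] /=.
- by rewrite (klinearD _ _ hlam) rmorphD mulrDl.
- by rewrite mulrDr.
- by rewrite (klinearZ _ _ hlam) rmorphM mulrCA mulrA.
Qed.

Lemma contract_pten b c : contract lam (pten f g b c) = g (lam b) * c.
Proof. by rewrite /contract tlift_ten //; apply: contract_bal. Qed.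

Lemma contract_zmod : zmod_morphism (contract lam).
Proof. exact: (tlift_is_additive contract_bal). Qed.

Definition contract_morph : {additive pushout f g -> C} :=
  HB.pack (contract lam) (GRing.isZmodMorphism.Build _ _ _ contract_zmod).
End Contract.

Lemma pushout_sum (x : pushout f g) :
  {s : seq (B * C) | x = \sum_(p <- s) pten f g p.1 p.2}.
Proof. exact: tens_sum. Qed.

Lemma contract_sum lam (s : seq (B * C)) : klinear lam ->
  contract lam (\sum_(p <- s) pten f g p.1 p.2) = \sum_(p <- s) g (lam p.1) * p.2.
Proof.
move=> hlam; rewrite -[LHS]/(contract_morph hlam _) raddf_sum.
by apply: eq_bigr => p _; rewrite /= contract_pten.
Qed.

(** Induction on the number of terms of the sum. If the left factor [a] of the first term is a
    combination of the others, the first term is absorbed into them. Otherwise a functional equal to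
    1 at [a] and to 0 at the other left factors shows that the right factor [b] vanishes. *)
Lemma contract_eq0 (x : pushout f g) :
  (forall lam, klinear lam -> contract lam x = 0) -> x = 0.
Proof.
have [s ->] := pushout_sum x.
have [n] := ubnP (size s); elim: n s => [//|n IH] [|[a b] s] /= sn h.
  by rewrite big_nil.
pose W y := exists t : seq k, size t = size s /\
  y = \sum_(p <- zip t s) f p.1 * p.2.1.
have [[t [ts aE]]|nWa] := pselect (W a).
  rewrite big_cons /=.
  (* A term whose left factor is a combination of the others is absorbed by moving the scalars
     across the tensor sign. *)
  have E (t' : seq k) (s' : seq (B * C)) : size t' = size s' ->
      pten f g (\sum_(p <- zip t' s') f p.1 * p.2.1) b +
        \sum_(p <- s') pten f g p.1 p.2 =
      \sum_(p <- [seq (p.2.1, g p.1 * b + p.2.2) | p <- zip t' s']) pten f g p.1 p.2.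
    have [bl br bb] := pten_balanced f g.
    elim: t' s' => [|c t' IHt] [|p s'] //=.
      by rewrite !big_nil (balanced0l (pten_balanced f g)) addr0.
    case=> /IHt; rewrite !big_cons /= bl bb br => <-.
    by rewrite -!addrA; congr (_ + _); rewrite addrCA.
  rewrite aE E //; apply: IH.
    by rewrite size_map size_zip ts minnn; move: sn; rewrite ltnS => /leq_trans; apply.
  move=> lam hlam; rewrite -E // -aE -(h lam hlam) big_cons //.
have [||lam [hlam lW la]] := exists_klinear _ _ nWa.
- exists (nseq (size s) 0); rewrite size_nseq; split=> //.
  elim: (s) => [|p s' IHs] /=; first by rewrite big_nil.
  by rewrite big_cons /= rmorph0 mul0r add0r.
- move=> c _ _ [t [ts ->]] [t' [ts' ->]].
  exists [seq c * p.1 + p.2 | p <- zip t t'].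
  rewrite size_map size_zip ts ts' minnn; split=> //.
  elim: (s) t t' ts ts' => [|p s' IHs] [|u t] [|u' t'] //=; first by rewrite !big_nil mulr0 addr0.
  case=> /IHs{}IHs [] /IHs{}IHs; rewrite !big_cons /= -IHs mulrDr addrACA.
  by rewrite rmorphD rmorphM mulrDl mulrA.
have ls p : p \in s -> lam p.1 = 0.
  move=> ps; apply: lW; pose i := index p s.
  exists [seq (j == i)%:R | j <- iota 0 (size s)]; rewrite size_map size_iota; split=> //.
  rewrite -(nth_index p ps) -/i.
  have il : (i < size s)%N by rewrite index_mem.
  rewrite (big_nth (0, p)) size_zip size_map size_iota minnn big_mkord.
  rewrite (bigD1 (Ordinal il)) //= nth_zip ?size_map ?size_iota //=.
  rewrite (nth_map 0%N) ?size_iota // nth_iota // add0n eqxx rmorph1 mul1r.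
  rewrite big1 ?addr0 // => j ji; rewrite nth_zip ?size_map ?size_iota //=.
  rewrite (nth_map 0%N) ?size_iota // nth_iota // add0n.
  by move: ji; rewrite -val_eqE /= => /negPf ->; rewrite rmorph0 mul0r.
have b0 : b = 0.
  move: (h lam hlam); rewrite contract_sum // big_cons /= la rmorph1 mul1r.
  rewrite big_seq big1 ?addr0 // => p ps; by rewrite ls // rmorph0 mul0r.
rewrite big_cons /= b0 (balanced0r (pten_balanced f g)) add0r.
apply: IH => // mu hmu; move: (h mu hmu).
by rewrite !contract_sum // big_cons /= b0 mulr0 add0r.
Qed.

(** Take [rho] to be the identity of [B] tensored with a functional [mu] on [C] such that
    [mu 1 = 1]. With [C] = kbar, this is what lets automorphisms descend from B (x)_k kbar to
    [B]. *)
Lemma pushout_retraction : (1 : C) <> 0 -> exists rho : pushout f g -> B,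
  [/\ zmod_morphism rho, forall b x, rho (pinl f g b * x) = b * rho x & rho 1 = 1].
Proof.
move=> nz.
have [||mu [hmu _ mu1]] := @exists_functional k (restr_of g) (fun x => x = 0) 1.
- by split=> // a x y -> ->; rewrite scaler0 addr0.
- by [].
have bal : balanced (fun a b => f a * b) (fun a c => g a * c)
    (fun b c => b * f (mu c)).
  have muD x y : mu (x + y) = mu x + mu y.
    by have := hmu 1 x y; rewrite scale1r mul1r.
  have mu0 : mu 0 = 0 by apply: (addrI (mu 0)); rewrite -muD !addr0.
  have muZ c x : mu (g c * (x : C)) = c * mu x.
    by have := hmu c x 0; rewrite mu0 !addr0.
  split=> [x y c|x c d|a b c] /=.
  - by rewrite mulrDl.
  - by rewrite [mu _]muD rmorphD mulrDr.
  - by rewrite muZ rmorphM mulrCA mulrA.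
exists (tlift (fun b c => b * f (mu c))); split.
- exact: (tlift_is_additive bal).
- move=> b; apply: (@tens_ext _ _ _ _ _ _
    (fun x : pushout f g => tlift (fun b c => b * f (mu c)) (pinl f g b * x))
    (fun x : pushout f g => b * tlift (fun b c => b * f (mu c)) x)).
  + by move=> x y; rewrite mulrBr (tlift_is_additive bal).
  + by move=> x y; rewrite (tlift_is_additive bal) mulrBr.
  move=> b' c; rewrite -/(pten f g b' c) ptenM mul1r !tlift_ten //.
  by rewrite mulrA.
- by rewrite [tlift _ _]tlift_ten // mu1 rmorph1 mulr1.
Qed.

End FieldPushout.

(* Hilbert's theorem 90, with the solution w = (lambda (x) 1)(v) of
   (w (x) 1) v = 1 (x) w for a linear functional lambda.  It is a unit as soon
   as it is nonzero because the ideal w B satisfies B (x) wB = wB (x) B, hence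
   is 0 or B. *)
Lemma Hilbert90 (k : fieldType) (B : comPzRingType) (f : {rmorphism k -> B})
  (T := pushout f f) (i1 := pinl f f : {rmorphism B -> T})
  (i2 := pinr f f : {rmorphism B -> T})
  (T3 := pushout f (i1 \o f)) (j1 := pinl f (i1 \o f) : {rmorphism B -> T3})
  (j2 := pinr f (i1 \o f) : {rmorphism T -> T3})
  (v12 v13 : {rmorphism T -> T3}) (v v' : T) :
  (1 : B) <> 0 -> v * v' = 1 ->
  (forall b, v12 (i1 b) = j1 b) -> (forall b, v12 (i2 b) = j2 (i1 b)) ->
  (forall b, v13 (i1 b) = j1 b) -> (forall b, v13 (i2 b) = j2 (i2 b)) ->
  v12 v * j2 v = v13 v ->
  exists w w' : B, w * w' = 1 /\ i1 w * v = i2 w.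
Proof.
move=> nz vv' h12l h12r h13l h13r coc.
(* With v12, [j2] and v13 placing an element of B (x) B in the factors 1-2, 2-3 and 1-3 of the
   triple product, apply [lam] to the first factor of the cocycle identity. *)
have key lam : klinear f lam ->
    i1 (contract lam v : B) * v = i2 (contract lam v : B).
  move=> hlam.
  pose L := contract_morph (i1 \o f) hlam.
  pose l := contract_morph f hlam.
  transitivity (L (v13 v)).
    rewrite -coc -[contract lam v]/(l v).
    have E x t : i1 (l x) * t = L (v12 x * j2 t).
      apply: (@tens_ext _ _ _ _ _ _ (fun x : T => i1 (l x) * t)
        (fun x : T => L (v12 x * j2 t))).
      - by move=> y z; rewrite raddfB rmorphB mulrBl.
      - by move=> y z; rewrite rmorphB mulrBl raddfB.
      move=> a b; rewrite -/(pten f f a b) /l /= contract_pten // rmorphM -mulrA.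
      rewrite ptenE rmorphM h12l h12r -mulrA -rmorphM.
      by rewrite /j1 /j2 -ptenE contract_pten.
    exact: E.
  rewrite -[contract lam v]/(l v).
  apply: (@tens_ext _ _ _ _ _ _ (fun x : T => L (v13 x)) (fun x : T => i2 (l x))).
  - by move=> y z; rewrite !raddfB.
  - by move=> y z; rewrite !raddfB.
  move=> a b; rewrite -/(pten f f a b) /l /= contract_pten // rmorphM.
  rewrite ptenE rmorphM h13l h13r /j1 /j2 -ptenE contract_pten //=.
  by rewrite /i1 /i2 /= pinlr.
(* If every functional gave 0, then v = 0 by [contract_eq0], and the multiplication map B (x) B -> B
   would send v v' = 1 to 0. *)
have [lam hlam wn0] : exists2 lam, klinear f lam & contract (g := f) lam v <> 0.
  apply: contrapT => h; apply: nz.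
  have v0 : v = 0.
    apply: contract_eq0 => lam hlam; apply: contrapT => ne; apply: h.
    by exists lam.
  have idK a : (idfun : {rmorphism B -> B}) (f a) = (idfun : {rmorphism B -> B}) (f a) by [].
  by rewrite -(rmorph1 (pcopair idK)) -vv' v0 mul0r rmorph0.
set w := contract lam v in wn0.
have kw : i1 w * v = i2 w := key _ hlam.
have [[w' ww']|nw] := pselect (exists w', w * w' = 1); first by exists w, w'.
(* If w is not a unit, some functional [mu] kills the ideal w B and has value 1 at 1. Applied to the
   left factor of (w (x) 1) v = 1 (x) w, it gives 0 on one side and w on the other. *)
have [|||mu [hmu muw mu1]] := @exists_klinear _ _ f (fun x => exists b, x = w * b) 1.
- by exists 0; rewrite mulr0.
- by move=> c _ _ [a ->] [b ->]; exists (f c * a + b); rewrite mulrDr mulrCA.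
- by case=> b /esym h; apply: nw; exists b.
case: wn0.
have := congr1 (contract_morph f hmu) kw.
rewrite /i2 /= contract_pten // mu1 rmorph1 mul1r => <-.
apply: (@tens_ext _ _ _ _ _ _
  (fun x : T => contract_morph f hmu (i1 w * x)) (fun=> 0)).
- by move=> x y; rewrite mulrBr raddfB.
- by move=> x y; rewrite subr0.
move=> a b; rewrite -/(pten f f a b) ptenM /= contract_pten // muw ?rmorph0 ?mul0r //.
by exists a.
Qed.

(** * Roots of unity *)

Lemma exists_root_extension (B : comNzRingType) (w : B) n : (0 < n)%N ->
  exists (C : comNzRingType) (psi : {rmorphism B -> C}) (y : C), y ^+ n = psi w.
Proof.
move=> n_gt0; pose h : {poly B} := 'X^n - w%:P.
exists {poly %/ h}, (in_qpoly h \o polyC : {rmorphism B -> {poly %/ h}}), (in_qpoly h 'X).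
apply/eqP; rewrite -subr_eq0 -rmorphXn -rmorphB; apply/eqP/val_inj => /=.
have hm : h \is monic by apply: monicXnsubC.
have -> : mk_monic h = h by rewrite /mk_monic size_XnsubC // ltnS n_gt0 hm.
exact: (Pdiv.RingMonic.rmodpp hm).
Qed.

(** The universal algebra with an n-th root of [w] is finitely presented by construction, and it is
    nonzero because it maps to the nonzero ring B[X]/(X^n - w). *)
Lemma adjoin_root (B : comPzRingType) (w : B) n : (1 : B) <> 0 -> (0 < n)%N ->
  exists (C : comPzRingType) (phi : {rmorphism B -> C}) (y : C),
    [/\ finitely_presented phi, y ^+ n = phi w & (1 : C) <> 0].
Proof.
move=> nz n_gt0.
pose fs : seq (seq (B * {ffun 'I_1 -> nat})) :=
  [:: [:: (1, [ffun=> n]); (- w, [ffun=> 0%N])]].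
have val (C : comPzRingType) (psi : {rmorphism B -> C}) (c : 'I_1 -> C) :
    fpmodel fs psi c <-> c ord0 ^+ n = psi w.
  have E : polyval psi (head [::] fs) c = c ord0 ^+ n - psi w.
    rewrite /polyval big_cons big_seq1 /= !big_ord1 !ffunE.
    by rewrite rmorph1 mul1r expr0 mulr1 rmorphN.
  split=> [/(_ _ (mem_head _ _))|h f]; last first.
    by rewrite inE => /eqP ->; rewrite E h subrr.
  by rewrite E => /eqP; rewrite subr_eq0 => /eqP.
exists (fpring fs), (fpconst fs), (fpvar fs ord0); split.
- exact: fp_finitely_presented.
- by have /val := @fp_model _ _ fs.
pose B' : comNzRingType := HB.pack (GRing.ComPzRing.sort B) (GRing.ComPzRing.class B)
  (GRing.PzSemiRing_isNonZero.Build B (introN eqP nz)).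
have [C [psi [y /= yw]]] := @exists_root_extension B' w n n_gt0.
have hm : fpmodel fs (psi : {rmorphism B -> C}) (fun=> y) by apply/val.
move/(congr1 (fpeval_morph hm)); rewrite rmorph1 rmorph0 => /eqP.
by rewrite oner_eq0.
Qed.

Section RootsOfUnity.
Variables (K : closedFieldType) (n : nat).
Hypothesis nK : n%:R != 0 :> K.

Lemma root_n_gt0 : (0 < n)%N.
Proof. by rewrite lt0n; apply: contraNneq nK => ->. Qed.

Lemma mu_roots : exists rs : seq K,
  [/\ uniq rs, forall z, (z \in rs) = (z \in mu K n) &
    forall p : {poly K}, (forall z, z \in rs -> root p z) -> ('X^n - 1 %| p)].
Proof.
have [rs] := closed_field_poly_normal ('X^n - 1 : {poly K}).
rewrite (monicP (monicXnsubC 1 root_n_gt0)) scale1r => rsE.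
have U : uniq rs.
  by rewrite -separable_prod_XsubC -rsE cyclotomic.separable_Xn_sub_1.
exists rs; split=> // [z|p pr].
  by rewrite -root_prod_XsubC -rsE.
by rewrite rsE; apply: uniq_roots_dvdp; [apply/allP|rewrite uniq_rootsE].
Qed.

(** Since n is invertible, X^n - 1 has distinct roots in [K], and the Lagrange polynomials at these
    roots are orthogonal idempotents with sum 1 modulo X^n - 1. Evaluated at [h], they give the
    partition. *)
Lemma constant_point_mu_nz (R : comNzRingType) (phi : {rmorphism K -> R}) (h : R) :
  h ^+ n = 1 -> constant_point (mu K n) phi h.
Proof.
move=> hn; have [rs [U rsmu dvd]] := mu_roots.
pose ev : {rmorphism {poly K} -> R} := horner_morph (fun x => mulrC h (phi x)).
have evC a : ev a%:P = phi a by apply: horner_morphC.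
have evX : ev 'X = h by apply: horner_morphX.
have ev0 p q : (forall z, z \in rs -> p.[z] = q.[z]) -> ev p = ev q.
  move=> pq; apply/eqP; rewrite -subr_eq0 -rmorphB.
  have /dvdpP[r ->] : 'X^n - 1 %| p - q.
    by apply: dvd => z zrs; rewrite rootE hornerD hornerN pq // subrr.
  by rewrite rmorphM rmorphB rmorphXn rmorph1 evX hn subrr mulr0.
pose z (i : 'I_(size rs)) := rs`_i.
have zrs i : z i \in rs by rewrite mem_nth.
have zinj i j : (z i == z j) = (i == j) by rewrite nth_uniq.
pose N i := \prod_(j < size rs | j != i) (z i - z j).
have N0 i : N i != 0.
  by apply/prodf_neq0 => j ji; rewrite subr_eq0 zinj eq_sym.
pose E i : {poly K} := (N i)^-1 *: \prod_(j < size rs | j != i) ('X - (z j)%:P).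
have Ez i j : (E i).[z j] = (i == j)%:R.
  rewrite hornerZ horner_prod; have [<-|ij] := eqVneq i j.
    rewrite (eq_bigr (fun j => z i - z j)) ?mulVf //.
    by move=> l _; rewrite hornerXsubC.
  by rewrite (bigD1 j) 1?eq_sym //= hornerXsubC subrr mul0r mulr0.
have rsz x : x \in rs -> {i | x = z i}.
  move=> xrs; have il : (index x rs < size rs)%N by rewrite index_mem.
  by exists (Ordinal il); rewrite /z /= nth_index.
exists (size rs), (fun i => ev (E i)), z; split.
- by move=> i; rewrite -rsmu.
- move=> i j; rewrite -rmorphM.
  transitivity (ev (if i == j then E i else 0)); last by case: eqP; rewrite ?rmorph0.
  apply: ev0 => _ /rsz[l ->]; rewrite hornerM !Ez.
  have [<-|ij] := eqVneq i j; first by rewrite Ez; case: eqP; rewrite ?mulr1 ?mulr0.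
  rewrite horner0; have [<-|] := eqVneq i l; last by rewrite mul0r.
  by rewrite eq_sym (negPf ij) mulr0.
- rewrite -rmorph_sum -(rmorph1 ev); apply: ev0 => _ /rsz[l ->].
  rewrite horner_sum hornerC (bigD1 l) //= Ez eqxx big1 ?addr0 // => i il.
  by rewrite Ez (negPf il).
- rewrite -evX; under eq_bigr do rewrite -evC -rmorphM.
  rewrite -rmorph_sum; apply: ev0 => _ /rsz[l ->].
  rewrite horner_sum hornerX (bigD1 l) //= hornerM Ez eqxx mul1r hornerC.
  rewrite big1 ?addr0 // => i il.
  by rewrite hornerM Ez (negPf il) mul0r.
Qed.

Lemma constant_point_mu (R : comPzRingType) (phi : {rmorphism K -> R}) (h : R) :
  constant_point (mu K n) phi h <-> h ^+ n = 1.
Proof.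
split=> [[m [e [z [zmu eE e1 ->]]]]|hn].
  have pw l : (\sum_i e i * phi (z i)) ^+ l = \sum_i e i * phi (z i) ^+ l.
    elim: l => [|l IH]; first by rewrite expr0 -e1; apply: eq_bigr => i _; rewrite mulr1.
    rewrite exprS IH mulr_suml; apply: eq_bigr => i _.
    rewrite mulr_sumr (bigD1 i) //= big1 ?addr0.
      by rewrite mulrACA eE eqxx exprS.
    by move=> j ji; rewrite mulrACA eE eq_sym (negPf ji) mul0r.
  rewrite pw -e1; apply: eq_bigr => i _.
  by have /unity_rootP zi := zmu i; rewrite -rmorphXn zi rmorph1 mulr1.
(* Over the zero ring the empty partition will do, all equations being trivial. *)
have [R0|nz] := pselect ((1 : R) = 0).
  have triv (x y : R) : x = y by rewrite -[x]mulr1 -[y]mulr1 R0 !mulr0.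
  exists 0%N, (fun=> 0), (fun=> 0); split=> [[]//|[]//||]; exact: triv.
pose R' : comNzRingType := HB.pack (GRing.ComPzRing.sort R) (GRing.ComPzRing.class R)
  (GRing.PzSemiRing_isNonZero.Build R (introN eqP nz)).
exact: (@constant_point_mu_nz R' phi h hn).
Qed.

End RootsOfUnity.

(** Multiplication by an element z of [G] permutes [G]; comparing products gives z^n = 1 for n =
    #|G|, and there are at most n roots of unity of order dividing n. If the characteristic p
    divided n, injectivity of Frobenius would make all n elements roots of X^(n/p) - 1. *)
Lemma finite_mul_subgroup_mu (K : fieldType) (G : {pred K}) :
  finite_mul_subgroup G -> exists n, [/\ (0 < n)%N, G = mu K n &
    forall p, p \in [pchar K] -> coprime n p].
Proof.
move=> [G0 G1 GM GV [s0 Gs0]]; pose s := undup s0.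
have Us : uniq s by apply: undup_uniq.
have Gs z : (z \in G) = (z \in s) by rewrite mem_undup -Gs0.
have n_gt0 : (0 < size s)%N by rewrite lt0n size_eq0; apply/eqP => s00; rewrite Gs s00 in G1.
have root_s z : z \in G -> z ^+ size s = 1.
  move=> zG; have z0 : z != 0 by apply: contraNneq G0 => <-.
  have perm : perm_eq [seq z * x | x <- s] s.
    apply: uniq_perm => //; first by rewrite map_inj_uniq //; apply: mulfI.
    move=> x; apply/mapP/idP=> [[y ys ->]|xs]; first by rewrite -Gs GM // Gs.
    by exists (z^-1 * x); rewrite ?mulVKf // -Gs GM ?GV // Gs.
  have P0 : \prod_(x <- s) x != 0.
    rewrite big_seq; apply: (big_ind (fun x => x != 0)) => [|x y x0 y0|x xs].
    - exact: oner_neq0.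
    - by rewrite mulf_neq0.
    - by apply: contraNneq G0 => <-; rewrite Gs.
  apply: (mulIf P0); rewrite mul1r -[in RHS](perm_big _ perm) big_map big_split /=.
  by rewrite big_const_seq count_predT -Monoid.iteropE.
exists (size s); split=> //; first apply: funext => z.
  apply/idP/idP=> [zG|zmu]; first by apply/unity_rootP/root_s.
  apply: contraT => zG; have /negP[] : ~~ (size (z :: s) <= size s)%N by rewrite /= ltnn.
  apply: max_unity_roots => //=; last by rewrite Us -Gs zG.
  apply/andP; split; first exact: zmu.
  by apply/allP => x xs; apply/unity_rootP/root_s; rewrite Gs.
move=> p pch; have p_pr := pcharf_prime pch.
rewrite coprime_sym prime_coprime //; apply/negP => pn.
have m_gt0 : (0 < size s %/ p)%N by rewrite divn_gt0 ?prime_gt0 // dvdn_leq.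
suff : (size s <= size s %/ p)%N.
  by rewrite leqNgt ltn_Pdiv ?prime_gt1.
apply: max_unity_roots => //; apply/allP => x xs; apply/unity_rootP.
apply: (fmorph_inj (pFrobenius_aut pch)); rewrite rmorph1.
by rewrite -[LHS]exprM divnK // root_s // Gs.
Qed.

(** * Torsors *)

Section Units.
Variable R : comPzRingType.
Implicit Types u v w : Gm R.

Lemma gvalV u : gval u * gval (ginv u) = 1.
Proof. by case: u => [[u u'] h]; apply/eqP. Qed.

Lemma gval_inj : injective (@gval R).
Proof.
move=> [[u u'] /= hu] [[v v'] /= hv]; rewrite /gval /= => uv.
apply: val_inj => /=; rewrite -uv in hv *; congr (_, _).
by rewrite -[u']mul1r -(eqP hv) mulrAC (eqP hu) mul1r.
Qed.

Lemma gvalM u v : gval (gmul u v) = gval u * gval v. Proof. by []. Qed.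
Lemma gval1 : gval (gone R) = 1. Proof. by []. Qed.

Lemma gmulA u v w : gmul u (gmul v w) = gmul (gmul u v) w.
Proof. by apply: gval_inj; rewrite !gvalM mulrA. Qed.
Lemma gmulC u v : gmul u v = gmul v u.
Proof. by apply: gval_inj; rewrite !gvalM mulrC. Qed.
Lemma gmul1 u : gmul (gone R) u = u.
Proof. by apply: gval_inj; rewrite gvalM mul1r. Qed.
Lemma gmulg1 u : gmul u (gone R) = u.
Proof. by rewrite gmulC gmul1. Qed.
Lemma gmulV u : gmul u (ginv u) = gone R.
Proof. by apply: gval_inj; rewrite gvalM gvalV. Qed.
Lemma gmulK u v : gmul (gmul u v) (ginv v) = u.
Proof. by rewrite -gmulA gmulV gmulg1. Qed.
Lemma ginv1 : ginv (gone R) = gone R.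
Proof. by rewrite -[LHS]gmul1 gmulV. Qed.

Fixpoint gexp u n : Gm R := if n is n'.+1 then gmul u (gexp u n') else gone R.
Lemma gvalX u n : gval (gexp u n) = gval u ^+ n.
Proof. by elim: n => [|n IH]; rewrite ?expr0 // exprS -IH. Qed.

End Units.

Lemma gval_map (R S : comPzRingType) (f : {rmorphism R -> S}) (u : Gm R) :
  gval (gmap f u) = f (gval u).
Proof. by []. Qed.

Lemma gmap1 (R S : comPzRingType) (f : {rmorphism R -> S}) :
  gmap f (gone R) = gone S.
Proof. by apply: gval_inj; rewrite gval_map rmorph1. Qed.

Lemma gmap_id (k : fieldType) (A : kalg k) (u : Gm A) : gmap (kid A) u = u.
Proof. exact: gval_inj. Qed.

Definition kfrom (k : fieldType) (A : kalg k) : khom (kself k) A :=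
  @KHom k (kself k) A (kstr A) (fun=> erefl).

Lemma khomE (k : fieldType) (A : kalg k) (f : khom (kself k) A) c : f c = kstr A c.
Proof. exact: (kfun_str f c). Qed.

Section KPushout.
Variables (k : fieldType) (A B C : kalg k) (f : khom A B) (g : khom A C).

Definition kpush : kalg k := @KAlg k (pushout f g) (pinl f g \o kstr B).
Definition kinl : khom B kpush := @KHom k B kpush (pinl f g) (fun=> erefl).
Lemma kinr_str c : pinr f g (kstr C c) = kstr kpush c.
Proof. by rewrite /= -(kfun_str g) -(kfun_str f) pinlr. Qed.
Definition kinr : khom C kpush := @KHom k C kpush (pinr f g) kinr_str.
Lemma kinlr a : kinl (f a) = kinr (g a). Proof. exact: pinlr. Qed.

Section KCopair.
Variables (D : kalg k) (u : khom B D) (v : khom C D).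
Hypothesis uv : forall a, u (f a) = v (g a).
Lemma kcopair_str c : pcopair uv (kstr kpush c) = kstr D c.
Proof. by rewrite [LHS]pcopairl kfun_str. Qed.
Definition kcopair : khom kpush D := @KHom k kpush D (pcopair uv) kcopair_str.
Lemma kcopairl b : kcopair (kinl b) = u b. Proof. exact: pcopairl. Qed.
Lemma kcopairr c : kcopair (kinr c) = v c. Proof. exact: pcopairr. Qed.
End KCopair.
End KPushout.

Lemma kfrom_eq (k : fieldType) (A D : kalg k) (u : khom A D) (B : kalg k) (v : khom B D) :
  forall c : kself k, u (kfrom A c) = v (kfrom B c).
Proof. by move=> c; rewrite !kfun_str. Qed.

Lemma cover_inj (k : fieldType) (A : kalg k) m (B : 'I_m -> kalg k)
  (s : forall i, khom A (B i)) (x y : A) :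
  fppf_cover s -> (forall i, s i x = s i y) -> x = y.
Proof.
move=> cs sxy; apply/eqP; rewrite -subr_eq0; apply/eqP.
apply: (cover_separated (chi := idfun) cs) => i.
by rewrite [LHS](pinlr idfun (s i)) rmorphB sxy subrr rmorph0.
Qed.

Section TorsorTheory.
Variables (k : fieldType) (A : kalg k) (T : torsor A).

Lemma tact_inj (D : kalg k) (t : T D) : injective (fun u => tact T u t).
Proof.
move=> u v /= uv.
have [w [_ wu]] := @tsimply_transitive _ _ T D t (tact T v t) (fsym (tbase_act v t)).
by rewrite -(wu u uv) -(wu v).
Qed.

Lemma tact_ex (D : kalg k) (t t' : T D) :
  tbase T t =1 tbase T t' -> exists u, tact T u t = t'.
Proof. by move=> /tsimply_transitive[u [h _]]; exists u. Qed.

Lemma tres_ext (D E : kalg k) (f g : khom D E) (t : T D) :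
  f =1 g -> tres T f t = tres T g t.
Proof. by move=> /khom_eq ->. Qed.

Lemma tsep (D : kalg k) m (E : 'I_m -> kalg k) (s : forall i, khom D (E i)) (t t' : T D) :
  fppf_cover s -> tbase T t =1 tbase T t' ->
  (forall i, tres T (s i) t = tres T (s i) t') -> t = t'.
Proof.
move=> cs bt rt.
have [||t0 [_ u]] := @tsheaf _ _ T D (tbase T t) m E s cs (fun i => tres T (s i) t).
- by move=> i; exact: tbase_res.
- by move=> i j C a b ab; rewrite -!tres_comp; apply: tres_ext.
rewrite -(u t) //; apply: u; split=> // a; by rewrite bt.
Qed.

End TorsorTheory.

Section TorsorMorphism.
Variables (k : fieldType) (A B : kalg k) (T' : torsor B) (T : torsor A) (f : tmor T' T).

Lemma tm_inj (D : kalg k) (t t' : T' D) :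
  tbase T' t =1 tbase T' t' -> f D t = f D t' -> t = t'.
Proof.
move=> /tact_ex[u <-]; rewrite tm_act => ftt.
have -> : u = gone D by apply: (@tact_inj _ _ T _ (f D t)); rewrite /= -ftt tact1.
by rewrite tact1.
Qed.

(* Morphisms of torsors are cartesian. *)
Lemma tm_lift (t : T B) : tbase T t =1 tm_over f ->
  exists2 t' : T' B, tbase T' t' =1 id & f B t' = t.
Proof.
move=> bt; have [m [E [s [cs ne]]]] := tlocally_nonempty T'.
pose ti i := sval (cid (ne i)).
have bti i : tbase T' (ti i) =1 s i by exact: svalP (cid (ne i)).
have hu i : {u | tact T u (f _ (ti i)) = tres T (s i) t}.
  apply/cid/tact_ex => a.
  by rewrite tm_base tbase_res /= bti bt.
pose t'i i := tact T' (sval (hu i)) (ti i).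
have bt'i i : tbase T' (t'i i) =1 s i \o kid B.
  by move=> a; rewrite tbase_act bti.
have ft'i i : f _ (t'i i) = tres T (s i) t by rewrite tm_act (svalP (hu i)).
have [|t0 [[bt0 rt0] _]] := @tsheaf _ _ T' B (kid B) m E s cs t'i bt'i.
  move=> i j C a b ab; apply: tm_inj.
    by move=> x; rewrite !tbase_res /= !bt'i; exact: ab.
  by rewrite !tm_res !ft'i -!tres_comp; apply: tres_ext.
exists t0 => //; apply: (tsep cs).
  by move=> a; rewrite tm_base /= bt0 /= bt.
by move=> i; rewrite -tm_res rt0 ft'i.
Qed.

End TorsorMorphism.

(** * Marked objects *)

Section Marked.
Variables (k : fieldType) (X : overcat k) (F : overfun X (BGm k)).

Definition tor (A : kalg k) (x : X A) : torsor A := F A x.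
Definition tmo (A B : kalg k) (x : X A) (y : X B) (f : mor y x) :
  tmor (tor y) (tor x) := fmor F f.

Lemma tmo_over (A B : kalg k) (x : X A) (y : X B) (f : mor y x) :
  tm_over (tmo f) =1 over f.
Proof. exact: (fmor_over F f). Qed.
Definition push (A B : kalg k) (x : X A) (y : X B) (f : mor y x) (D : kalg k)
  (t : tor y D) : tor x D := tmo f D t.
Arguments push {A B x y} f {D} t.

Lemma push_id (A D : kalg k) (x : X A) (t : tor x D) : push (mid x) t = t.
Proof. by rewrite /push /tmo fmor_id. Qed.
Lemma push_comp (A B C D : kalg k) (x : X A) (y : X B) (z : X C)
  (f : mor y x) (g : mor z y) (t : tor z D) : push (mcomp f g) t = push f (push g t).
Proof. by rewrite /push /tmo fmor_comp. Qed.
Lemma push_base (A B D : kalg k) (x : X A) (y : X B) (f : mor y x) (t : tor y D) :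
  tbase (tor x) (push f t) =1 tbase (tor y) t \o over f.
Proof. by move=> a; rewrite tm_base /= tmo_over. Qed.
Lemma push_act (A B D : kalg k) (x : X A) (y : X B) (f : mor y x) (u : Gm D)
  (t : tor y D) : push f (tact _ u t) = tact _ u (push f t).
Proof. exact: tm_act. Qed.
Lemma push_res (A B D E : kalg k) (x : X A) (y : X B) (f : mor y x) (h : khom D E)
  (t : tor y D) : push f (tres _ h t) = tres _ h (push f t).
Proof. exact: tm_res. Qed.

(* Objects x with a trivialisation of F x, i.e. objects of the fibre product of
   X -> BGm <- Spec k. *)
Record marked (A : kalg k) := Marked {
  mx : X A;
  ms : tor mx A;
  ms_base : tbase (tor mx) ms =1 id }.

Definition hits (A B : kalg k) (m' : marked B) (m : marked A) (h : khom A B)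
  (u : Gm B) (f : mor (mx m') (mx m)) :=
  over f =1 h /\ push f (ms m') = tact _ u (tres _ h (ms m)).

(** Arrows are replaced by units: for faithful [F] the pair of [h] and [u] determines the arrow
    ([hits_inj]), and composition multiplies the units ([rel_comp]). *)
Definition rel (A B : kalg k) (m' : marked B) (m : marked A) (h : khom A B) (u : Gm B) :=
  exists f, @hits A B m' m h u f.

Lemma res_base (A D : kalg k) (m : marked A) (h : khom A D) :
  tbase (tor (mx m)) (tres _ h (ms m)) =1 h.
Proof. by move=> a; rewrite tbase_res /= ms_base. Qed.

Lemma point_ex (A D : kalg k) (m : marked A) (t : tor (mx m) D) :
  exists u, t = tact _ u (tres _ (tbase _ t) (ms m)).
Proof. by have [u e] := tact_ex (res_base m (tbase _ t)); exists u; rewrite e. Qed.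

Lemma hits_ext (A B : kalg k) (m' : marked B) (m : marked A) (h h' : khom A B) u f :
  h =1 h' -> @hits A B m' m h u f -> hits h' u f.
Proof. by move=> /khom_eq ->. Qed.

Lemma rel_ext (A B : kalg k) (m' : marked B) (m : marked A) (h h' : khom A B) u u' :
  h =1 h' -> gval u = gval u' -> rel m' m h u -> rel m' m h' u'.
Proof. by move=> /khom_eq -> /gval_inj ->. Qed.

Lemma rel_id (A : kalg k) (m : marked A) : rel m m (kid A) (gone A).
Proof.
exists (mid (mx m)); split; first exact: over_id.
by rewrite push_id tact1 tres_id.
Qed.

Lemma hits_comp (A B C : kalg k) (m : marked A) (m' : marked B) (m'' : marked C)
  h u h' u' f f' : @hits A B m' m h u f -> @hits B C m'' m' h' u' f' ->
  hits (kcomp h' h) (gmul (gmap h' u) u') (mcomp f f').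
Proof.
move=> [fo ft] [f'o f't]; split.
  by move=> a; rewrite over_comp /= fo f'o.
by rewrite push_comp f't push_act push_res ft tres_act -tres_comp -tactM gmulC.
Qed.

Lemma rel_comp (A B C : kalg k) (m : marked A) (m' : marked B) (m'' : marked C)
  h u h' u' : rel m' m h u -> rel m'' m' h' u' ->
  rel m'' m (kcomp h' h) (gmul (gmap h' u) u').
Proof. by move=> [f hf] [f' hf']; exists (mcomp f f'); apply: hits_comp. Qed.

Definition scaled (A : kalg k) (m : marked A) (v : Gm A) : marked A :=
  @Marked A (mx m) (tact _ v (ms m))
    (fun a => etrans (tbase_act v (ms m) a) (ms_base m a)).

Lemma rel_scaled (A : kalg k) (m : marked A) v : rel (scaled m v) m (kid A) v.
Proof.
exists (mid (mx m)); split; first exact: over_id.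
by rewrite push_id tres_id.
Qed.

Hypothesis faithF : faithful F.

(** A section of the torsor over any base is a unit times the restricted mark, so that a torsor
    morphism is determined by its base map and the image of the mark; faithfulness does the rest. *)
Lemma hits_inj (A B : kalg k) (m' : marked B) (m : marked A) h u f g :
  @hits A B m' m h u f -> @hits A B m' m h u g -> f = g.
Proof.
move=> [fo ft] [go gt]; apply: faithF; apply: tmor_eq.
  by move=> a; rewrite [LHS](tmo_over f) fo [RHS](tmo_over g) go.
move=> D t; have [v ->] := point_ex t.
by rewrite -[LHS]/(push f _) -[RHS]/(push g _) !push_act !push_res ft gt.
Qed.

Hypothesis fibX : fibered_in_groupoids X.

(** All arrows in a category fibered in groupoids are cartesian; the unit of the factor is the
    quotient of the given units. *)
Lemma rel_factor (A B C : kalg k) (m : marked A) (m' : marked B) (m'' : marked C)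
  (h : khom A B) u (h' : khom B C) (g : khom A C) u'' :
  rel m' m h u -> rel m'' m g u'' -> g =1 h' \o h ->
  rel m'' m' h' (gmul u'' (ginv (gmap h' u))).
Proof.
move=> [f [fo ft]] [f'' [f''o f''t]] gE.
have [|l [[lo fl] _]] := fibX.2 A B C _ _ _ f f'' h'.
  by move=> a; rewrite f''o gE /= fo.
exists l; split=> //.
have [|y ly] := @tact_ex _ _ (tor (mx m')) _ (tres _ h' (ms m')) (push l (ms m'')).
  by move=> a; rewrite res_base push_base /= ms_base lo.
rewrite -ly; congr (tact _ _ _).
have : push f (push l (ms m'')) = tact _ u'' (tres _ g (ms m)).
  by rewrite -push_comp fl.
rewrite -ly push_act push_res ft tres_act -tres_comp -tactM.
rewrite (@tres_ext _ _ _ _ _ (kcomp h' h) g); last by move=> a; rewrite gE.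
by move/tact_inj => <-; rewrite gmulK.
Qed.

Lemma pull_mark (A B : kalg k) (m : marked A) (y : X B) (f : mor y (mx m)) :
  exists2 s : tor y B, tbase _ s =1 id & push f s = tres _ (over f) (ms m).
Proof. by apply: tm_lift => a; rewrite res_base tmo_over. Qed.

Lemma pull_ex (A B : kalg k) (m : marked A) (h : khom A B) :
  exists m' : marked B, rel m' m h (gone B).
Proof.
have [y [f fo]] := fibX.1 A B h (mx m); have [s bs fs] := pull_mark f.
exists (Marked bs), f; split=> //; rewrite fs tact1; exact: tres_ext.
Qed.

Hypothesis descX : descent_for_arrows X.

(** The local arrows to [m'] agree on overlaps because each is determined by its unit, and all these
    units are restrictions of the single [u]. *)
Lemma rel_glue (A : kalg k) (m m' : marked A) n (B : 'I_n -> kalg k)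
  (s : forall i, khom A (B i)) (mi : forall i, marked (B i)) (u : Gm A) :
  fppf_cover s -> (forall i, rel (mi i) m (s i) (gone _)) ->
  (forall i, rel (mi i) m' (s i) (gmap (s i) u)) -> rel m m' (kid A) u.
Proof.
move=> cs r1 r2.
pose f i := sval (cid (r1 i)); pose g i := sval (cid (r2 i)).
have fP i : hits (s i) (gone _) (f i) by exact: svalP (cid (r1 i)).
have gP i : hits (s i) (gmap (s i) u) (g i) by exact: svalP (cid (r2 i)).
have [|||h [[ho hf] _]] := descX cs (f := f) (g := g).
- by move=> i; case: (fP i).
- by move=> i; case: (gP i).
- move=> i j D y p q fpq.
  have [sg bsg psg] := pull_mark p.
  pose my := Marked bsg.
  have [v qv] := point_ex (push q sg).
  have bq : tbase _ (push q sg) =1 over q by move=> a; rewrite push_base /= bsg.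
  have hp : hits (over p) (gone D) (p : mor (mx my) (mx (mi i))) by split; rewrite ?tact1.
  have hq : hits (over q) v (q : mor (mx my) (mx (mi j))).
    split=> //; rewrite [LHS]qv; congr (tact _ _ _); exact: tres_ext.
  have h1 := hits_comp (fP i) hp; have h2 := hits_comp (fP j) hq.
  have ov : kcomp (over p) (s i) =1 kcomp (over q) (s j).
    by move=> a; rewrite -[LHS](h1.1) -[RHS](h2.1) fpq.
  have v1 : v = gone D.
    move: h2.2; rewrite -fpq h1.2 !gmap1 !gmul1 (tres_ext _ ov).
    by move/tact_inj.
  have h3 := hits_comp (gP i) hp; have h4 := hits_comp (gP j) hq.
  apply: (hits_inj h3); apply: (hits_ext (fsym ov)).
  have -> : gmul (gmap (over p) (gmap (s i) u)) (gone D) =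
            gmul (gmap (over q) (gmap (s j) u)) v.
    by rewrite v1; congr gmul; apply/gval_inj/ov.
  exact: h4.
exists h; split=> //.
apply: (tsep cs).
  by move=> a; rewrite push_base /= ms_base ho tbase_act res_base.
move=> i; rewrite tres_id tres_act -push_res.
have [fo ft] := fP i; have [go gt] := gP i.
rewrite tact1 in ft.
by rewrite -ft -push_comp hf gt.
Qed.

Hypothesis lconX : locally_connected X.

Lemma rel_local (A : kalg k) (m m' : marked A) :
  exists n (B : 'I_n -> kalg k) (s : forall i, khom A (B i)),
    fppf_cover s /\ forall i, exists (mi : marked (B i)) (u : Gm (B i)),
      rel mi m (s i) (gone _) /\ rel mi m' (s i) u.
Proof.
have [n [B [s [cs con]]]] := lconX (mx m) (mx m').
exists n, B, s; split=> // i; have [z [f [g [fo go]]]] := con i.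
have [sg bsg fsg] := pull_mark f.
have [|u gu] := @tact_ex _ _ (tor (mx m')) _ (tres _ (s i) (ms m')) (push g sg).
  by move=> a; rewrite res_base push_base /= bsg go.
exists (Marked bsg), u; split; last by exists g; split.
exists f; split=> //; rewrite fsg tact1; exact: tres_ext.
Qed.

Lemma rel_comp1 (A B C : kalg k) (m : marked A) (m' : marked B) (m'' : marked C)
  h h' u' : rel m' m h (gone _) -> rel m'' m' h' u' -> rel m'' m (kcomp h' h) u'.
Proof. by move=> r r'; have := rel_comp r r'; rewrite gmap1 gmul1. Qed.

Lemma rel_factor1 (A B C : kalg k) (m : marked A) (m' : marked B) (m'' : marked C)
  (h : khom A B) (h' : khom B C) (g : khom A C) u'' :
  rel m' m h (gone _) -> rel m'' m g u'' -> g =1 h' \o h -> rel m'' m' h' u''.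
Proof.
by move=> r r'' gE; have := rel_factor r r'' gE; rewrite gmap1 ginv1 gmulg1.
Qed.

Lemma rel_sym (A : kalg k) (m m' : marked A) u :
  rel m m' (kid A) u -> rel m' m (kid A) (ginv u).
Proof.
move=> r; have := rel_factor (h' := kid A) (g := kid A) r (rel_id m') (frefl _).
by rewrite gmul1 gmap_id.
Qed.

(* If R -> E has an R-linear retraction rho, automorphisms descend along it:
   they are the R-points of an affine scheme, and z in E with equal images in
   E (x)_R E is rho z. *)
Hypothesis repX : isom_representable X.

Lemma aut_descent (A E : kalg k) (i : khom A E) (rho : E -> A) (m : marked A)
  (mE : marked E) (u : Gm A) :
  zmod_morphism rho -> (forall a x, rho (i a * x) = a * rho x) -> rho 1 = 1 ->
  rel mE m i (gone E) -> rel mE mE (kid E) (gmap i u) -> rel m m (kid A) u.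
Proof.
move=> rhoB rhoZ rho1 [f fP] [al alP].
have rhoD x y : rho (x + y) = rho x + rho y.
  have rho0 : rho 0 = 0 by rewrite -(subrr 0) rhoB subrr.
  have rhoN z : rho (- z) = - rho z by rewrite -(sub0r z) rhoB rho0 sub0r.
  by rewrite -[y in LHS]opprK rhoB rhoN opprK.
have rhoK a : rho (i a) = a by rewrite -[i a]mulr1 rhoZ rho1 mulr1.
have iinj : injective i by apply: (can_inj (g := rho)).
have [H [s [z [a [b [_ ao bo univ]]]]]] := repX (mx m) (mx m).
have f'P := hits_comp fP alP.
(* The ring map [over w] from [H] to [E] is the [E]-point of the automorphism scheme of [m] that
   corresponds to [al]. *)
have [|w [[aw bw] _]] := univ E (mx mE) f (mcomp f al).
  by move=> x; rewrite fP.1 f'P.1.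
pose j1 := kinl i i; pose j2 := kinr i i.
have [m2 [b1 b1P]] := pull_ex mE j1.
have j12 : kcomp j1 i =1 kcomp j2 i by move=> x; exact: (kinlr i i).
have c1P := hits_comp fP b1P.
have [b2 [b2P fb]] : exists b2, hits j2 (gone _) b2 /\ mcomp f b1 = mcomp f b2.
  have [|||b2 b2P] := @rel_factor1 _ _ _ m mE m2 i j2 (kcomp j2 i) (gone _) => //.
  - by exists f.
  - exists (mcomp f b1); apply: (hits_ext j12).
    by have := c1P; rewrite gmap1 gmul1.
  exists b2; split=> //; apply: (hits_inj c1P); apply: (hits_ext (fsym j12)).
  have := hits_comp fP b2P; by rewrite !gmap1.
(* The pullbacks of [al] to the two sides of E (x)_A E have the same unit, since [u] comes from [A];
   hence they coincide, and so do the corresponding points of [H]. *)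
have th x : j1 (over w x) = j2 (over w x).
  have wb : mcomp w b1 = mcomp w b2.
    have [|w2 [_ uw]] := univ _ _ (mcomp f b1) (mcomp (mcomp f al) b1).
      move=> y; rewrite c1P.1 (hits_comp f'P b1P).1 //=.
    rewrite -(uw (mcomp w b1)); last by rewrite !mcompA aw bw.
    apply: uw; rewrite !mcompA aw bw; split=> //.
    apply: (hits_inj (hits_comp f'P b2P)).
    apply: (@hits_ext _ _ _ _ (kcomp j1 (kcomp (kid E) i))
      (kcomp j2 (kcomp (kid E) i)) _ _ j12).
    rewrite (_ : gmul _ _ = gmul (gmap j1 (gmul (gmap (kid E) (gone E)) (gmap i u))) (gone _)).
      exact: hits_comp f'P b1P.
    apply: gval_inj; rewrite !gvalM !gval_map !gvalM !gval_map !gval1 !rmorph1 !mulr1 !mul1r.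
    exact/esym/j12.
  by have := over_comp w b1 x; rewrite wb over_comp /= b1P.1 b2P.1.
(* Apply p (x) q |-> p i(rho q) to x (x) 1 = 1 (x) x, where x now stands for its image in [E]. *)
have thi x : over w x = i (rho (over w x)).
  have bal : balanced (fun a b => i a * b) (fun a b => i a * b)
      (fun p q : E => p * i (rho q)).
    split=> [p p' q|p q q'|c p q] /=.
    - by rewrite mulrDl.
    - by rewrite rhoD rmorphD mulrDr.
    - by rewrite rhoZ rmorphM mulrCA mulrA.
  have := congr1 (tlift (fun p q : E => p * i (rho q))) (th x).
  rewrite [LHS]tlift_ten // [RHS]tlift_ten //= rho1 rmorph1 mulr1 mul1r //.
pose th0 x := rho (over w x).
have th0B : zmod_morphism th0 by move=> x y; rewrite /th0 rmorphB rhoB.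
have th0M : monoid_morphism th0.
  split=> [|x y]; first by rewrite /th0 rmorph1.
  by apply: iinj; rewrite rmorphM -!thi rmorphM.
pose th0m : {rmorphism H -> A} := HB.pack th0
  (GRing.isZmodMorphism.Build _ _ th0 th0B) (GRing.isMonoidMorphism.Build _ _ th0 th0M).
have th0k c : th0m (kstr H c) = kstr A c.
  by apply: iinj; rewrite -[i (th0m _)]thi !kfun_str.
pose t0 : khom H A := KHom th0k.
have wE : over w =1 i \o t0 by move=> x; exact: thi.
have [z0 [g go]] := fibX.1 H A t0 z.
have st0 : t0 \o s =1 id.
  move=> x; apply: iinj; have := wE (s x); rewrite /= => <-.
  have := over_comp a w x; rewrite aw fP.1 => ->; by rewrite /= ao.
(* The descended automorphism is d c^(-1). Its unit [u0] is compared with [u] after pullback to [E],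
   where [i] is injective. *)
pose c := mcomp a g; pose d := mcomp b g.
have co : over c =1 kid A by move=> x; rewrite over_comp /= go ao; exact: st0.
have do' : over d =1 kid A by move=> x; rewrite over_comp /= go bo; exact: st0.
have [sg bsg csg] := pull_mark c.
pose mz := Marked bsg.
have cP : hits (kid A) (gone A) (c : mor (mx mz) (mx m)).
  split=> //; rewrite csg tact1; exact: tres_ext.
have [|u0 du] := @tact_ex _ _ (tor (mx m)) _ (tres _ (kid A) (ms m)) (push d sg).
  by move=> x; rewrite res_base push_base /= bsg do'.
have dP : hits (kid A) u0 (d : mor (mx mz) (mx m)) by split.
have [l [[lo gl] _]] := fibX.2 _ _ _ _ _ _ g w i (fun x => etrans (wE x) (congr1 i (esym (go x)))).
have cl : mcomp c l = f by rewrite /c -mcompA gl aw.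
have dl : mcomp d l = mcomp f al by rewrite /d -mcompA gl bw.
have [y ly] := @point_ex _ _ mz (push l (ms mE)).
have lP : hits i y (l : mor (mx mE) (mx mz)).
  split=> //; rewrite [LHS]ly; congr (tact _ _ _); apply: tres_ext => x.
  by rewrite push_base /= ms_base lo.
have y1 : y = gone E.
  have := (hits_comp cP lP).2; rewrite cl fP.2 gmap1 gmul1.
  rewrite (@tres_ext _ _ _ _ _ (kcomp i (kid A)) i) //.
  by move/tact_inj.
have uu0 : u0 = u.
  have := (hits_comp dP lP).2; rewrite dl f'P.2 y1 gmap1 gmul1 gmulg1.
  rewrite (@tres_ext _ _ _ _ _ (kcomp (kid E) i) i) //.
  rewrite (@tres_ext _ _ _ _ _ (kcomp i (kid A)) i) //.
  move/tact_inj => uu; apply/gval_inj/iinj.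
  by rewrite -!gval_map uu.
have rc : rel mz m (kid A) (gone A) by exists c.
have rd : rel mz m (kid A) u0 by exists d.
have rc' := rel_sym rc; rewrite ginv1 in rc'.
have := rel_comp rd rc'; rewrite gmap_id gmulg1 uu0; exact: rel_ext.
Qed.

End Marked.

(** * Descent of a rescaled mark *)

Section GeometricAutomorphisms.
Variables (k : fieldType) (X : overcat k) (F : overfun X (BGm k)).
Hypotheses (gerbeX : gerbe X) (faithF : faithful F).

Let fibX : fibered_in_groupoids X. Proof. by case: gerbeX => -[]. Qed.
Let descX : descent_for_arrows X. Proof. by case: gerbeX => -[]. Qed.
Let lconX : locally_connected X. Proof. by case: gerbeX. Qed.
Let repX : isom_representable X. Proof. by case: gerbeX. Qed.

Notation mk := (@marked k X F).

(** Conjugation by the arrow m' -> m leaves the unit of an automorphism unchanged because Gm is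
    commutative. *)
Lemma aut_pull (A B : kalg k) (m : mk A) (m' : mk B) h w u :
  rel m' m h w -> rel m m (kid A) u -> rel m' m' (kid B) (gmap h u).
Proof.
move=> r r0; have := rel_factor fibX (h' := kid B) r (rel_comp r0 r) (frefl _).
by rewrite gmap_id gmulK.
Qed.

Lemma rel_normalize (A B : kalg k) (m : mk A) (m' : mk B) h w :
  rel m' m h w -> exists2 m1 : mk B, rel m1 m h (gone B) & rel m1 m' (kid B) (ginv w).
Proof.
move=> r; exists (scaled m' (ginv w)); last exact: rel_scaled.
apply: rel_ext (rel_comp r (rel_scaled m' (ginv w))) => //.
by rewrite gmap_id gmulV.
Qed.

(** [C] will be kbar and [pm] the geometric point with its trivialisation. The hypothesis [geom] is
    the condition on a j-gerbe for mu_n, with the conjugation by an element of Gm cancelled. *)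
Variables (C : kalg k) (pm : mk C) (n : nat).
Hypothesis C_nz : (1 : C) <> 0.
Hypothesis geom : forall (R : kalg k) (f : khom C R) (u : Gm R),
  (exists m' : mk R, rel m' pm f (gone R) /\ rel m' m' (kid R) u) <->
  gval u ^+ n = 1.

(** * Automorphisms of an arbitrary marked object *)

Section Fixed.
Variables (A : kalg k) (m : mk A) (u : Gm A).
Let E := kpush (kfrom A) (kfrom C).
Let iA : khom A E := kinl (kfrom A) (kfrom C).
Let iC : khom C E := kinr (kfrom A) (kfrom C).

Lemma kpush_retraction : exists rho : E -> A,
  [/\ zmod_morphism rho, forall a x, rho (iA a * x) = a * rho x & rho 1 = 1].
Proof. exact: (@pushout_retraction k A C (kstr A) (kstr C) C_nz). Qed.

(** Local connectedness links [m] to the geometric point: over A (x)_k C both have pullbacks, and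
    these become isomorphic on a covering. *)
Lemma aut_local : exists (mE : mk E) l (B : 'I_l -> kalg k)
    (s : forall i, khom E (B i)) (mi mi' : forall i, mk (B i)),
  [/\ rel mE m iA (gone E), fppf_cover s, forall i, rel (mi i) mE (s i) (gone _),
      forall i, rel (mi' i) pm (kcomp (s i) iC) (gone _)
    & forall i, exists w, rel (mi' i) (mi i) (kid _) w].
Proof.
have [mE rE] := pull_ex fibX m iA; have [pE rpE] := pull_ex fibX pm iC.
have [l [B [s [cs loc]]]] := rel_local lconX mE pE.
have hmi i : {p : mk (B i) * mk (B i) | [/\ rel p.1 mE (s i) (gone _),
    rel p.2 pm (kcomp (s i) iC) (gone _) & exists w, rel p.2 p.1 (kid _) w]}.
  apply: cid; have [mi [w [r1 r2]]] := loc i; have [mi' r3 r4] := rel_normalize (rel_comp1 rpE r2).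
  by exists (mi, mi'); split=> //; exists (ginv w).
exists mE, l, B, s, (fun i => (sval (hmi i)).1), (fun i => (sval (hmi i)).2).
by split=> // i; case: (svalP (hmi i)).
Qed.

(** From left to right, pull the automorphism back to the covering of A (x)_k C and transport it to
    [pm]. Conversely, [geom] provides local automorphisms with unit [u], which glue over A (x)_k C
    by [rel_glue] and descend to [A] by [aut_descent]. *)
Lemma aut_root : rel m m (kid A) u <-> gval u ^+ n = 1.
Proof.
have [mE [l [B [s [mi [mi' [rE cs rmi rmi' rw]]]]]]] := aut_local.
have [rho [rhoB rhoZ rho1]] := kpush_retraction.
have iinj : injective iA.
  by apply: (can_inj (g := rho)) => a; rewrite -[iA a]mulr1 rhoZ rho1 mulr1.
split=> [r|un].
  apply: iinj; rewrite rmorphXn rmorph1; apply: (cover_inj cs) => i.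
  rewrite rmorphXn rmorph1.
  have r1 := aut_pull (rel_comp1 rE (rmi i)) r.
  have [w r2] := rw i; have r3 := aut_pull r2 r1.
  have := (geom _ _).1 (ex_intro _ _ (conj (rmi' i) r3)).
  by rewrite !gval_map.
apply: (aut_descent faithF fibX repX rhoB rhoZ rho1 rE).
apply: (rel_glue faithF descX cs rmi) => i.
have un_i : gval (gmap (s i) (gmap iA u)) ^+ n = 1.
  have : s i (iA (gval u ^+ n)) = 1 by rewrite un !rmorph1.
  by rewrite 2!rmorphXn.
have [m3 [r3 r3u]] := (geom (kcomp (s i) iC) (gmap (s i) (gmap iA u))).2 un_i.
have [w rww] := rw i.
have r4 := rel_factor1 fibX r3 (rmi' i) (h' := kid _) (frefl _).
have r5 := aut_pull r4 r3u.
have r6 := rel_sym fibX rww.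
have r7 := aut_pull r6 r5.
have := rel_comp1 (rmi i) r7.
by apply: rel_ext => //.
Qed.

End Fixed.

(** The condition over [f] identifies the two marked objects, after which the arrows over [g] differ
    by an automorphism, whose unit is an n-th root of unity. *)
Lemma rel_power_eq (A R : kalg k) (m : mk A) (mu mu' : mk R) (f g : khom A R) u u' :
  rel mu m f (gone R) -> rel mu m g u -> rel mu' m f (gone R) -> rel mu' m g u' ->
  gval u ^+ n = gval u' ^+ n.
Proof.
move=> r1 r2 r1' r2'.
have r := rel_factor1 fibX r1 r1' (h' := kid R) (frefl _).
have r3 := rel_comp r2 r.
have := rel_factor fibX (h' := kid R) (g := g) r3 r2' (frefl _).
move/aut_root; rewrite gmap_id gmulg1 gvalM gmap_id => h.
by rewrite -[LHS]mulr1 -h -exprMn mulrCA gvalV mulr1.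
Qed.

(** * The cocycle v = u^n and its trivialisation *)

Section DifferenceCocycle.
Variables (B : kalg k) (m : mk B).
Let T := kpush (kfrom B) (kfrom B).
Let i1 : khom B T := kinl (kfrom B) (kfrom B).
Let i2 : khom B T := kinr (kfrom B) (kfrom B).

(* The trivialisations of the two pullbacks of m to T are compared by a unit u
   which exists locally and is unique up to n-th roots of unity; v = u^n is
   global. *)
Lemma difference_ex : exists v : Gm T, forall (R : kalg k) (f : khom T R) (mu : mk R) u,
  rel mu m (kcomp f i1) (gone R) -> rel mu m (kcomp f i2) u ->
  gval u ^+ n = f (gval v).
Proof.
have [m1 r1] := pull_ex fibX m i1; have [m2 r2] := pull_ex fibX m i2.
have [l [Ti [s [cs loc]]]] := rel_local lconX m1 m2.
have hmi i : {p : mk (Ti i) * Gm (Ti i) |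
    rel p.1 m (kcomp (s i) i1) (gone _) /\ rel p.1 m (kcomp (s i) i2) p.2}.
  apply: cid; have [mi [u [h1 h2]]] := loc i.
  by exists (mi, u); split; [apply: rel_comp1 r1 _|apply: rel_comp1 r2 _].
pose mi i := (sval (hmi i)).1; pose ui i := (sval (hmi i)).2.
have ri1 i : rel (mi i) m (kcomp (s i) i1) (gone _) by case: (svalP (hmi i)).
have ri2 i : rel (mi i) m (kcomp (s i) i2) (ui i) by case: (svalP (hmi i)).
have agree (D : kalg k) (f : khom T D) i (a : khom (Ti i) D) (mu : mk D) u :
    f =1 a \o s i -> rel mu m (kcomp f i1) (gone D) -> rel mu m (kcomp f i2) u ->
    gval u ^+ n = a (gval (ui i) ^+ n).
  move=> fE h1 h2; have [mu' r'] := pull_ex fibX (mi i) a.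
  rewrite rmorphXn; apply: (rel_power_eq h1 h2 (mu' := mu') (u' := gmap a (ui i))).
    apply: rel_ext (rel_comp (ri1 i) r') => [x|]; first by rewrite /= fE.
    by rewrite gmap1 gmul1.
  apply: rel_ext (rel_comp (ri2 i) r') => [x|]; first by rewrite /= fE.
  by rewrite gmulg1.
(* The local units u_i^n are glued by the sheaf property of the torsor of [m2]: acting on its mark
   turns units into sections. *)
pose ti i := tact (tor F (mx m2)) (gexp (ui i) n) (tres _ (s i) (ms m2)).
have bti i : tbase _ (ti i) =1 s i \o kid T.
  by move=> a; rewrite tbase_act res_base.
have [|t0 [[bt0 rt0] _]] := tsheaf (f := kid T) cs bti.
  move=> i j D a b ab; rewrite /ti !tres_act -!tres_comp.
  rewrite (tres_ext (g := kcomp b (s j))) //; congr (tact _ _ _); apply: gval_inj.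
  rewrite !gval_map !gvalX.
  have [mu r] := pull_ex fibX (mi i) a.
  have h1 := rel_comp1 (ri1 i) r; have h2 := rel_comp (ri2 i) r.
  rewrite -(agree D (kcomp b (s j)) j b mu (gmap a (ui i))) //.
  - by rewrite rmorphXn.
  - by apply: rel_ext h1 => // x; apply: ab.
  - by apply: rel_ext h2 => [x|]; [apply: ab|rewrite gmulg1].
have [v vt0] := point_ex t0.
have vE i : s i (gval v) = gval (ui i) ^+ n.
  have := rt0 i; rewrite vt0 tres_act -tres_comp /ti.
  rewrite (tres_ext (g := s i)); last by move=> a; rewrite /= bt0.
  by move/tact_inj => h; rewrite -gvalX -h.
(* The formula is tested on the covering R (x)_T T_i of [R], where the given arrows can be compared
   with those of [mi i]. *)
exists v => R f mu u h1 h2; apply/eqP; rewrite -subr_eq0; apply/eqP.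
apply: (cover_separated (chi := f) cs) => i.
pose a := kinl f (s i); pose b := kinr f (s i).
have [mu' r'] := pull_ex fibX mu a.
rewrite rmorphB -/(a _) -/(a _); apply/eqP; rewrite subr_eq0; apply/eqP.
rewrite [RHS](pinlr f (s i)) -[pinr f (s i) _]/(b _) vE.
rewrite -(agree _ (kcomp a f) i b mu' (gmap a u)).
- by rewrite gval_map rmorphXn.
- exact: (kinlr f (s i)).
- exact: rel_ext (rel_comp1 h1 r').
- by apply: rel_ext (rel_comp h2 r') => //; rewrite gmulg1.
Qed.

(** The cocycle identity is checked on two successive coverings of B (x) B (x) B, after which the
    three pullbacks of [m] are isomorphic. The resulting w serves for all pairs of maps from [B] to
    [R], since these factor through B (x) B. *)
Lemma difference_coboundary : (1 : B) <> 0 ->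
  exists w w' : B, w * w' = 1 /\
  forall (R : kalg k) (f g : khom B R) (mu : mk R) u,
    rel mu m f (gone R) -> rel mu m g u -> f w * gval u ^+ n = g w.
Proof.
move=> B_nz; have [v hv] := difference_ex.
pose T3 := kpush (kfrom B) (kfrom T).
pose j1 : khom B T3 := kinl (kfrom B) (kfrom T).
pose j2 : khom T T3 := kinr (kfrom B) (kfrom T).
pose v12 : khom T T3 := kcopair (kfrom_eq j1 (kcomp j2 i1)).
pose v13 : khom T T3 := kcopair (kfrom_eq j1 (kcomp j2 i2)).
have v12l b : v12 (i1 b) = j1 b by apply: kcopairl.
have v12r b : v12 (i2 b) = j2 (i1 b) by apply: kcopairr.
have v13l b : v13 (i1 b) = j1 b by apply: kcopairl.
have v13r b : v13 (i2 b) = j2 (i2 b) by apply: kcopairr.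
have coc : v12 (gval v) * j2 (gval v) = v13 (gval v).
  have [m1 r1] := pull_ex fibX m j1.
  have [m2 r2] := pull_ex fibX m (kcomp j2 i1).
  have [m3 r3] := pull_ex fibX m (kcomp j2 i2).
  have [l [D [s [cs loc]]]] := rel_local lconX m1 m2.
  apply: (cover_inj cs) => i; have [mu [u [h1 h2]]] := loc i.
  have [m3' r3'] := pull_ex fibX m3 (s i).
  have [l' [D' [s' [cs' loc']]]] := rel_local lconX mu m3'.
  apply: (cover_inj cs') => j; have [nu [w [h3 h4]]] := loc' j.
  pose q := kcomp (s' j) (s i).
  have e1 : rel nu m (kcomp q j1) (gone _).
    by apply: rel_ext (rel_comp1 r1 (rel_comp1 h1 h3)).
  have e2 : rel nu m (kcomp q (kcomp j2 i1)) (gmap (s' j) u).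
    apply: rel_ext (rel_comp1 r2 (rel_comp h2 h3)) => //.
    by rewrite gmulg1.
  have e3 : rel nu m (kcomp q (kcomp j2 i2)) w.
    by apply: rel_ext (rel_comp1 r3 (rel_comp1 r3' h4)).
  have a12 : gval (gmap (s' j) u) ^+ n = q (v12 (gval v)).
    apply: (hv _ (kcomp q v12) nu).
      by apply: rel_ext e1 => // b; rewrite /= v12l.
    by apply: rel_ext e2 => // b; rewrite /= v12r.
  have a13 : gval w ^+ n = q (v13 (gval v)).
    apply: (hv _ (kcomp q v13) nu).
      by apply: rel_ext e1 => // b; rewrite /= v13l.
    by apply: rel_ext e3 => // b; rewrite /= v13r.
  have [nu' e2' rnu'] := rel_normalize e2.
  (* Rescaling the mark so that the second comparison has unit 1 makes the unit between the second
     and third pullbacks equal to u13 / u12. *)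
  have a23 : gval (gmul w (ginv (gmap (s' j) u))) ^+ n = q (j2 (gval v)).
    apply: (hv _ (kcomp q j2) nu'); first exact: rel_ext e2'.
    by apply: rel_ext (rel_comp e3 rnu') => //; rewrite gmap_id.
  rewrite -[LHS]/(q (v12 (gval v) * j2 (gval v))) -[RHS]/(q (v13 (gval v))).
  rewrite rmorphM -a12 -a13 -a23 -exprMn; congr (_ ^+ _).
  by rewrite gvalM mulrCA gvalV mulr1.
have [w [w' [ww' hw]]] := @Hilbert90 k B (kstr B) v12 v13 (gval v) (gval (ginv v))
  B_nz (gvalV v) v12l v12r v13l v13r coc.
exists w, w'; split=> // R f g mu u h1 h2.
pose c : khom T R := kcopair (kfrom_eq f g).
have cl b : c (i1 b) = f b by apply: kcopairl.
have cr b : c (i2 b) = g b by apply: kcopairr.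
rewrite (hv R c mu u); first by rewrite -cl -cr -[i2 w]hw rmorphM.
- by apply: rel_ext h1 => // x; rewrite /= cl.
- by apply: rel_ext h2 => // x; rewrite /= cr.
Qed.

End DifferenceCocycle.

(** After the mark is multiplied by y, with y^n = w, the coboundary relation says that the local
    units comparing two pullbacks have n-th power 1. By [aut_root] they can be cancelled by
    automorphisms; the comparisons with unit 1 are unique and glue. *)
Lemma rescaled_unique (B : kalg k) (m : mk B) : (1 : B) <> 0 -> (0 < n)%N ->
  exists (B' : kalg k) (phi : khom B B') (m' : mk B'),
    [/\ finitely_presented phi, (1 : B') <> 0 &
      forall (D : kalg k) (f g : khom B' D), exists mu : mk D,
        rel mu m' f (gone D) /\ rel mu m' g (gone D)].
Proof.
move=> B_nz n_gt0; have [w [w' [ww' hw]]] := difference_coboundary m B_nz.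
have [R [phi0 [y [fp yw R_nz]]]] := adjoin_root w B_nz n_gt0.
pose B' : kalg k := @KAlg k R (phi0 \o kstr B).
pose phi : khom B B' := @KHom k B B' phi0 (fun=> erefl).
have yunit : y * (y ^+ n.-1 * phi w') == 1.
  by rewrite mulrA -exprS prednK // yw -rmorphM ww' rmorph1.
pose yG : Gm B' := exist _ (y, y ^+ n.-1 * phi w') yunit.
have [m1 r1] := pull_ex fibX m phi.
have r' : rel (scaled m1 yG) m phi yG.
  apply: rel_ext (rel_comp r1 (rel_scaled m1 yG)) => //.
  by rewrite gmap1 gmul1.
set m' := scaled m1 yG in r'.
exists B', phi, m'; split=> // D f g.
have [mf rf] := pull_ex fibX m' f; have [mg rg] := pull_ex fibX m' g.
have [l [Di [s [cs loc]]]] := rel_local lconX mf mg.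
have hmi i : {mi : mk (Di i) | rel mi mf (s i) (gone _) /\ rel mi mg (s i) (gone _)}.
  apply: cid; have [mu [u [h1 h2]]] := loc i; exists mu; split=> //.
  pose a := gmap (kcomp (s i) f) yG; pose b := gmap (kcomp (s i) g) yG.
  have e1 : rel mu m (kcomp (kcomp (s i) f) phi) a.
    by apply: rel_ext (rel_comp r' (rel_comp1 rf h1)) => //; rewrite gmulg1.
  have e2 : rel mu m (kcomp (kcomp (s i) g) phi) (gmul b u).
    exact: rel_ext (rel_comp r' (rel_comp1 rg h2)).
  have [nu h1' rnu] := rel_normalize e1.
  have := hw _ _ _ _ _ h1' (rel_comp e2 rnu).
  have -> : kcomp (kcomp (kid (Di i)) (kcomp (s i) g)) phi w = gval b ^+ n.
    by rewrite gval_map /= -yw !rmorphXn.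
  have -> : kcomp (kcomp (s i) f) phi w = gval a ^+ n.
    by rewrite gval_map /= -yw !rmorphXn.
  rewrite gmap_id -exprMn !gvalM mulrCA gvalV mulr1 exprMn => E.
  have un : gval (ginv u) ^+ n = 1.
    have U1 : gval u ^+ n = 1.
      have bb : gval (ginv b) ^+ n * gval b ^+ n = 1.
        by rewrite mulrC -exprMn gvalV expr1n.
      by rewrite -[LHS]mul1r -bb -mulrA E.
    by rewrite -[LHS]mul1r -U1 -exprMn gvalV expr1n.
  have ru := (aut_root mu (ginv u)).2 un.
  by apply: rel_ext (rel_comp h2 ru) => //; rewrite gmap_id gmulV.
have := rel_glue faithF descX cs (fun i => (svalP (hmi i)).1) (u := gone D).
move=> /(_ mg) h.
have {}h : rel mf mg (kid D) (gone D).
  by apply: h => i; rewrite gmap1; case: (svalP (hmi i)).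
exists mf; split=> //.
by apply: rel_ext (rel_comp1 rg h).
Qed.

Section Descent.
Variables (B : kalg k) (m : mk B).
Hypothesis glue : forall (D : kalg k) (f g : khom B D), exists mu : mk D,
  rel mu m f (gone D) /\ rel mu m g (gone D).

(** The arrows [p] and [g] induce the same mark on [y]. Existence and uniqueness of [g] define the
    gluing; reflexivity and transitivity of the relation give the identity and cocycle axioms of the
    descent datum. *)
Definition matches (D : kalg k) (y : X D) (p : mor y (mx m)) (b : khom B D)
    (g : mor y (mx m)) :=
  exists s : tor F y D, [/\ tbase _ s =1 id,
    push p s = tres _ (over p) (ms m), over g =1 b & push g s = tres _ b (ms m)].

Lemma section_inj (D : kalg k) (y : X D) (p : mor y (mx m)) (s s' : tor F y D) :
  tbase _ s =1 id -> tbase _ s' =1 id -> push p s = push p s' -> s = s'.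
Proof. by move=> bs bs'; apply: tm_inj => a; rewrite bs bs'. Qed.

Lemma matches_ex (D : kalg k) (y : X D) (p : mor y (mx m)) (b : khom B D) :
  exists g, matches p b g.
Proof.
have [s bs ps] := pull_mark p; have [mu [r1 r2]] := glue (over p) b.
have rp : rel (Marked bs) m (over p) (gone D) by exists p; split; rewrite ?tact1.
have r := rel_factor1 fibX r1 rp (h' := kid D) (frefl _).
have [g [go gs]] := rel_comp1 r2 r.
exists g, s; split=> //; rewrite [LHS]gs tact1; exact: tres_ext.
Qed.

Lemma matches_inj (D : kalg k) (y : X D) (p : mor y (mx m)) (b b' : khom B D) g g' :
  b =1 b' -> matches p b g -> matches p b' g' -> g = g'.
Proof.
move=> /khom_eq <- [s [bs ps go gs]] [s' [bs' ps' go' gs']].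
have ss' : s = s' by apply: (@section_inj _ _ p _ _ bs bs'); rewrite ps ps'.
rewrite -ss' in gs'.
apply: (@hits_inj _ _ _ faithF _ _ (Marked bs) m b (gone D)).
  by split; rewrite ?tact1.
by split; rewrite ?tact1.
Qed.

Lemma matches_comp (D D' : kalg k) (y : X D) (y' : X D') (p g : mor y (mx m))
  (q : mor y' y) (b : khom B D) :
  matches p b g -> matches (mcomp p q) (kcomp (over q) b) (mcomp g q).
Proof.
move=> [s [bs ps go gs]]; have [s' bs' qs'] := @pull_mark _ _ F _ _ (Marked bs) _ q.
exists s'; split=> //.
- rewrite push_comp qs' push_res ps -tres_comp; apply: tres_ext => a.
  by rewrite over_comp.
- by move=> a; rewrite over_comp /= go.
- by rewrite push_comp qs' push_res gs -tres_comp.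
Qed.

Lemma matches_id (D : kalg k) (y : X D) (p : mor y (mx m)) : matches p (over p) p.
Proof. by have [s bs ps] := pull_mark p; exists s. Qed.

Lemma matches_trans (D : kalg k) (y : X D) (p g h : mor y (mx m)) (b c : khom B D) :
  matches p b g -> matches g c h -> matches p c h.
Proof.
move=> [s [bs ps go gs]] [s' [bs' gs' ho hs']]; exists s; split=> //.
have -> // : s = s'.
by apply: (@section_inj _ _ g _ _ bs bs'); rewrite gs gs'; apply: tres_ext => a; rewrite go.
Qed.

Lemma descend : finitely_presented (kstr B) -> (1 : B) <> 0 -> inhabited (X (kself k)).
Proof.
move=> fp B_nz.
pose s (i : 'I_1) : khom (kself k) B := kfrom B.
(* The only prime of the field is 0, and any prime of the nonzero ring [B] lies over it. *)
have cs : fppf_cover s.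
  split=> [i|i|P prP]; [exact: flat_field|exact: fp|].
  have idz : ideal (fun x : B => x = 0).
    by split=> // [x y -> ->|a x ->]; rewrite ?addr0 ?mulr0.
  have [Q prQ _] := exists_prime_above idz B_nz.
  exists ord0, Q; split=> // c.
  have [[P0 P1] _ PM _] := prP; have [[Q0 Q1] _ QM _] := prQ.
  have [->|c0] := eqVneq (c : k) 0; first by rewrite rmorph0; split.
  split=> h; exfalso.
    apply: Q1; rewrite -(rmorph1 (s ord0)) -(mulVf c0) rmorphM; exact: QM.
  by apply: P1; rewrite -(mulVf c0); apply: PM.
have descO : descent_for_objects X by case: gerbeX => -[].
pose dg (D : kalg k) (y : X D) (p : mor y (mx m)) (b : khom B D) :=
  sval (cid (matches_ex p b)).
have dgP D y p b : matches p b (@dg D y p b) by exact: svalP (cid (matches_ex p b)).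
have d : descent_datum X s.
  apply: (@DescentDatum k X (kself k) 1 (fun=> B) s
    (fun=> mx m) (fun i j D y p b _ => dg D y p b)).
  - by move=> i j D y p b _; case: (dgP D y p b) => t [].
  - move=> i j D D' y y' p q b b' _ _ bb'.
    by apply: (matches_inj (b' := kcomp (over q) b) bb' (dgP _ _ _ _)); exact/matches_comp/dgP.
  - move=> i D y p _; exact: (matches_inj (frefl _) (dgP _ _ _ _) (matches_id p)).
  - move=> i j l D y p b c _ _ _.
    exact: (matches_inj (frefl _) (matches_trans (dgP _ _ _ _) (dgP _ _ _ _)) (dgP _ _ _ _)).
have [x _] := descO _ _ _ s cs d.
by exists.
Qed.

End Descent.

(** One covering yields an object, a second one trivialises its torsor. Lifting the prime 0 of k
    through both selects members that are nonzero rings. *)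
Lemma exists_marked : exists (B : kalg k) (m : mk B),
  finitely_presented (kstr B) /\ (1 : B) <> 0.
Proof.
have nonzero (A : kalg k) (Q : A -> Prop) : prime_ideal Q -> (1 : A) <> 0.
  by case=> -[Q0 Q1] _ _ _ h; apply: Q1; rewrite h.
have pr0 : prime_ideal (fun x : kself k => x = 0).
  split=> [|x y -> ->|a x ->|x y].
  - by split=> //; apply/eqP/oner_neq0.
  - by rewrite addr0.
  - by rewrite mulr0.
  - by move/eqP; rewrite mulf_eq0 => /orP[] /eqP; [left|right].
have [_ lne _ _] := gerbeX; have [l [B1 [s1 [[_ fp1 lift1] ne]]]] := lne (kself k).
have [i [Q [prQ _]]] := lift1 _ pr0; have [x] := ne i.
have [l' [B2 [s2 [[_ fp2 lift2] ne2]]]] := tlocally_nonempty (tor F x).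
have [j [Q2 [prQ2 _]]] := lift2 _ prQ; have [t bt] := ne2 j.
have [y [f fo]] := fibX.1 _ _ (s2 j) x.
have [|t' bt' _] := tm_lift (f := tmo F f) (t := t).
  by move=> a; rewrite bt tmo_over fo.
exists (B2 j), (Marked bt'); split; last exact: nonzero prQ2.
apply: finitely_presented_comp (fp1 i) (fp2 j) => c.
by rewrite /= khomE kfun_str.
Qed.

Lemma gerbe_point : (0 < n)%N -> inhabited (X (kself k)).
Proof.
move=> n_gt0; have [B [m [fpB B_nz]]] := exists_marked.
have [B' [phi [m' [fp B'_nz glue]]]] := rescaled_unique m B_nz n_gt0.
apply: (descend glue) => //.
by apply: finitely_presented_comp fpB fp => c; rewrite /= kfun_str.
Qed.

End GeometricAutomorphisms.

Lemma natr_neq0_coprime (K : fieldType) n : (0 < n)%N ->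
  (forall p, p \in [pchar K] -> coprime n p) -> n%:R != 0 :> K.
Proof.
move=> n_gt0 cop; apply/negP => nK0; have [p pK] := natf0_pchar n_gt0 nK0.
have := cop p pK; rewrite coprime_sym prime_coprime ?(pcharf_prime pK) //.
by rewrite (dvdn_pcharf pK) nK0.
Qed.

(** As Gm is commutative, conjugation by [c] disappears, and [constant_point_mu] turns the constant
    group of the definition into the equation u^n = 1. *)
Lemma neutral_mu (k0 : fieldType) (K : closedFieldType) (iota : {rmorphism k0 -> K})
  (n : nat) : n%:R != 0 :> K -> neutral iota (mu K n).
Proof.
move=> nK k j X F [gX fF [kbar [i [emb [_ _ [p [t [c [bt aut]]]]]]]]].
pose pm : marked F (KAlg i) := @Marked k X F (KAlg i) p t bt.
apply: (@gerbe_point _ _ _ gX fF (KAlg i) pm n) (root_n_gt0 nK).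
  exact/eqP/oner_neq0.
move=> R f u; rewrite -(@constant_point_mu _ _ nK _ (f \o emb : {rmorphism K -> R})).
have cancel_c g : gmul (gmul (gmap f c) g) (ginv (gmap f c)) = g.
  by rewrite [gmul (gmap f c) g]gmulC gmulK.
split=> [[m' [[q [qo qs]] [a [ao as_]]]]|h].
  have /aut[g [hg ->]] : aut_image (F := F) t f u.
    exists (mx m'), q, a, (ms m'); split=> //; first exact: ms_base.
      by rewrite [LHS]qs tact1.
    by rewrite [LHS]as_ tres_id.
  by rewrite cancel_c.
have /aut[p' [q [a [s [qo ao bs qs as_]]]]] :
    exists g, constant_point (mu K n) (f \o emb) (gval g) /\
      u = gmul (gmul (gmap f c) g) (ginv (gmap f c)).
  by exists u; rewrite cancel_c.
exists (@Marked k X F R p' s bs); split.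
  by exists q; split; rewrite ?tact1.
by exists a; split; rewrite ?tres_id.
Qed.

Theorem proposition5p1 (k0 : fieldType) (K : closedFieldType)
  (iota : {rmorphism k0 -> K}) (hk0 : perfect k0)
  (hK : forall x : K, algebraicOver iota x) :
  (forall n : nat, (1 <= n)%N ->
     (forall p : nat, p \in [pchar k0] -> coprime n p) ->
     neutral iota (mu K n)) /\
  (forall G : {pred K}, finite_mul_subgroup G -> neutral iota G).
Proof.
split=> [n n_gt0 cop|G /finite_mul_subgroup_mu[n [n_gt0 -> cop]]].
  apply: neutral_mu; apply: natr_neq0_coprime => // p pK; apply: cop.
  by rewrite -(fmorph_pchar iota).
exact/neutral_mu/natr_neq0_coprime.
Qed.
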